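(* Let $R$ be a root lattice of type $A_{n-1}$, $D_n$, $E_6$, $E_7$ or $E_8$. Let $\mathcal W_R$ be the subVOA of $V_{R\otimes E_8}$ generated by $\{e(\alpha):\alpha\in\Phi^+(R)\}$, and let $\mathcal G_R$ be the Griess subalgebra of $\mathcal W_R$ generated by $\{e(\alpha):\alpha\in\Phi^+(R)\}$, i.e. the subalgebra they generate in the weight two space $(\mathcal W_R)_2$ under the product $(u,v)\mapsto u_1v$. Then $\mathcal G_R=\mathrm{span}_{\mathbb C}\{e(\alpha):\alpha\in\Phi^+(R)\}$ and $\dim\mathcal G_R=\#(\Phi^+(R))$, the number of positive roots of $R$.
   Context: Root lattices. $R$ is one of the irreducible root lattices, in the standard model with $\{\epsilon_i\}$ an orthonormal basis of $\mathbb R^n$: $A_{n-1}=\{\sum_{i=1}^n a_i\epsilon_i: a_i\in\mathbb Z,\sum a_i=0\}$ ($n\ge2$), $D_n=\{\sum_{i=1}^n a_i\epsilon_i: a_i\in\mathbb Z,\sum a_i\in2\mathbb Z\}$ ($n\ge4$), $E_8=\mathrm{span}_{\mathbb Z}\{D_8,\frac12(\epsilon_1+\dots+\epsilon_8)\}$, $E_7=\{x\in E_8:\langle x,\frac12\sum_{i=1}^8\epsilon_i\rangle=0\}$, $E_6=\{x\in E_7:\langle x,\epsilon_1+\epsilon_8\rangle=0\}$ (take $n=8$ for type $E$). $\Phi(R)$ is the set of roots (norm 2 vectors) and $\Phi^+(R)$ a set of positive roots. The lattice $R\otimes E_8$ has form $\langle a\otimes b,a'\otimes b'\rangle=\langle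 a,a'\rangle\langle b,b'\rangle$. It is embedded in $\frac12X$, where $X=E_8^n$ (orthogonal sum), by $(\sum a_i\epsilon_i)\otimes\gamma\mapsto(a_1\gamma,\dots,a_n\gamma)$. Cocycle. Let $\{\alpha_1,\dots,\alpha_8\}$ be a basis of $E_8$ consisting of roots, $x_i=\alpha_i/2$, and let $\varepsilon_0:\frac12E_8\times\frac12E_8\to\mathbb Z/8$ be the bilinear map with $\varepsilon_0(x_i,x_j)=4\langle x_i,x_j\rangle$ for $i>j$, $\varepsilon_0(x_i,x_i)=1$, and $\varepsilon_0(x_i,x_j)=0$ for $i<j$. Extend to $\frac12X$ by $\varepsilon_0((a_i),(b_i))=\sum_i\varepsilon_0(a_i,b_i)$ and put $\varepsilon(a,b)=\exp(2\pi\sqrt{-1}\,\varepsilon_0(a,b)/8)$. Lattice VOA. For $L=R\otimes E_8$, $V_L=M(1)\otimes\mathbb C\{L\}$ is the lattice VOA over $\mathbb C$, with twisted group algebra $\mathbb C\{L\}=\mathrm{span}\{e^a:a\in L\}$, $e^ae^b=\varepsilon(a,b)e^{a+b}$. We write $Y(u,z)=\sum_nu_nz^{-n-1}$. For a sublattice $M$, $\omega_M=\frac12\sum_i h_i(-1)^2\mathbbm 1$, where $\{h_i\}$ is an orthonormal basis of $\mathbb C\otimes M$. For $\alpha\in\Phi(R)$ put $M_\alpha=\mathbb Z\alpha\otimes E_8\cong\sqrt2E_8$ ($\varepsilon$ is trivial on $M_\alpha$) and $$e(\alpha)=\tfrac1{16}\omega_{M_\alpha}+\tfrac1{32}\sum_{\beta\in\Phi^+(E_8)}(e^{\alpha\otimes\beta}+e^{-\alpha\otimes\beta}),$$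 an Ising vector with $e(\alpha)=e(-\alpha)$. *)

(* Defs.v *)
(* The complex numbers are [R[i]] with [R : realType].  All the lattices
   involved are rational, so they are sets of vectors (or matrices) over
   [rat]. *)
From HB Require Import structures.
From mathcomp Require Import all_boot all_order all_algebra.
From mathcomp Require Import finmap multiset.
From mathcomp Require Import complex.
From mathcomp Require Import boolp classical_sets fsbigop reals trigo.
From mathcomp Require Import monalg.

Set Implicit Arguments.
Unset Strict Implicit.
Unset Printing Implicit Defensive.

Import Order.TTheory GRing.Theory Num.Theory.

Local Open Scope fset_scope.
Local Open Scope mset_scope.
Local Open Scope classical_set_scope.
Local Open Scope complex_scope.
Local Open Scope ring_scope.

Section Spans.

Definition zspan (V : zmodType) : set V -> set V :=
  smallest [set G : set V | G 0 /\ (forall x y, G x -> G y -> G (x - y))].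

Definition is_subspace (F : fieldType) (V : lmodType F) (U : set V) : Prop :=
  U 0 /\ (forall (c : F) (x y : V), U x -> U y -> U (c *: x + y)).

Definition lspan (F : fieldType) (V : lmodType F) : set V -> set V :=
  smallest (@is_subspace F V).

Definition has_dim (F : fieldType) (V : lmodType F) (U : set V) (d : nat) :
    Prop :=
  exists b : 'I_d -> V,
    (forall c : 'I_d -> F, \sum_i c i *: b i = 0 -> forall i, c i = 0) /\
    U = lspan (range b).

End Spans.

(* The standard form on row vectors; on [n x 8] matrices it is the orthogonal
   sum of [n] copies of the standard form. *)
Definition dot (F : fieldType) (m n : nat) (A B : 'M[F]_(m, n)) : F :=
  \tr (A *m B^T).

Section RootLattices.

(* [latA n] is A_{n-1}. *)
Definition latA (n : nat) : set 'rV[rat]_n :=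
  [set v | (forall i, v 0 i \is a Num.int) /\ \sum_i v 0 i = 0].

Definition latD (n : nat) : set 'rV[rat]_n :=
  [set v | (forall i, v 0 i \is a Num.int) /\
           exists k : int, \sum_i v 0 i = 2 * k%:~R].

Definition half_ones : 'rV[rat]_8 := const_mx (1 / 2).

Definition latE8 : set 'rV[rat]_8 := zspan (@latD 8 `|` [set half_ones]).

Definition latE7 : set 'rV[rat]_8 := [set x | latE8 x /\ dot x half_ones = 0].

Definition latE6 : set 'rV[rat]_8 :=
  [set x | latE7 x /\ dot x (delta_mx 0 ord0 + delta_mx 0 ord_max) = 0].

Inductive is_root_lattice : forall n : nat, set 'rV[rat]_n -> Prop :=
| Root_A (n : nat) of (2 <= n)%N : is_root_lattice (@latA n)
| Root_D (n : nat) of (4 <= n)%N : is_root_lattice (@latD n)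
| Root_E6 : is_root_lattice latE6
| Root_E7 : is_root_lattice latE7
| Root_E8 : is_root_lattice latE8.

Definition roots (n : nat) (Q : set 'rV[rat]_n) : set 'rV[rat]_n :=
  [set v | Q v /\ dot v v = 2].

Definition positive_roots (n : nat) (Q : set 'rV[rat]_n)
    (P : {fset 'rV[rat]_n}) : Prop :=
  [/\ forall a, a \in P -> roots Q a,
      forall a, roots Q a -> (a \in P) != (- a \in P)
    & forall a b, a \in P -> b \in P -> roots Q (a + b) -> a + b \in P].

(* The rows of [B] are a Z-basis of E_8 consisting of roots. *)
Definition root_basis_E8 (B : 'M[rat]_8) : Prop :=
  [/\ forall i, roots latE8 (row i B),
      row_free B
    & zspan (range (fun i => row i B)) = latE8].

(* (\sum_i a_i eps_i) (x) g is the matrix whose i-th row is a_i g; thus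
   elements of (1/2)X are matrices with rows in (1/2)E_8. *)
Definition tens (n : nat) (a : 'rV[rat]_n) (g : 'rV[rat]_8) :
    'M[rat]_(n, 8) := a^T *m g.

Definition tensor_E8 (n : nat) (Q : set 'rV[rat]_n) : set 'M[rat]_(n, 8) :=
  zspan [set A | exists a g, [/\ Q a, latE8 g & A = tens a g]].

End RootLattices.

Section Cocycle.

Variables (R : realType) (B : 'M[rat]_8).

Definition half_basis (i : 'I_8) : 'rV[rat]_8 := 2^-1 *: row i B.

(* [Num.floor] converts to [int] a rational which is an integer in all the
   cases where [eps0] is meant to be used. *)
Definition eps0_basis (i j : 'I_8) : int :=
  if (j < i)%N then Num.floor (4 * dot (half_basis i) (half_basis j))
  else if i == j then 1 else 0.

(* Coordinates in the basis x_1, ..., x_8 of (1/2)E_8. *)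
Definition half_coord (a : 'rV[rat]_8) (i : 'I_8) : int :=
  Num.floor ((a *m invmx (2^-1 *: B)) 0 i).

Definition eps0_row (a b : 'rV[rat]_8) : 'Z_8 :=
  \sum_i \sum_j (half_coord a i * half_coord b j * eps0_basis i j)%:~R.

Definition eps0 (n : nat) (a b : 'M[rat]_(n, 8)) : 'Z_8 :=
  \sum_(i < n) eps0_row (row i a) (row i b).

Definition expi (t : R) : R[i] := cos t +i* sin t.

Definition eps (n : nat) (a b : 'M[rat]_(n, 8)) : R[i] :=
  expi (2 * pi * (eps0 a b : nat)%:R / 8).

End Cocycle.

Section LatticeVOA.

Variables (R : realType) (n : nat) (B : 'M[rat]_8).

Local Notation C := R[i].

(* [((i, j), k)] stands for the creation operator eps_ij(-k-1), where
   (eps_ij) is the standard orthonormal basis of the n x 8 matrices. *)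
Definition osc : choiceType := ('I_n * 'I_8 * nat)%type.

(* The pair [(s, a)] stands for \prod_(x in s) x (x) e^a. *)
Definition fock_key : choiceType := ({mset osc} * 'M[rat]_(n, 8))%type.

(* M(1) (x) C{Q^(n x 8)}, with M(1) the Heisenberg algebra of C^(n x 8): the
   common ambient space of all the V_L.  It is not itself a VOA. *)
Definition fock : lmodType C := {malg C[fock_key]}.

Definition fock_lin (f : fock_key -> fock) (v : fock) : fock :=
  \sum_(x <- msupp v) v@_x *: f x.

Definition ket (s : {mset osc}) (a : 'M[rat]_(n, 8)) : fock :=
  << 1 *g ((s, a) : fock_key) >>.

Definition vac : fock := ket mset0 0.

Definition expo (a : 'M[rat]_(n, 8)) : fock := ket mset0 a.

Definition heis_ij (p : 'I_n * 'I_8) (m : int) : fock -> fock :=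
  fock_lin (fun x =>
    match m with
    | Negz k => ket ((p, k) +` x.1)%mset x.2
    | Posz 0 => ratr (x.2 p.1 p.2) *: ket x.1 x.2
    | Posz k.+1 => (k.+1 * x.1 (p, k))%:R *: ket (x.1 `\ (p, k))%mset x.2
    end).

(* The operator h(m), for h in C^(n x 8). *)
Definition heis (h : 'M[C]_(n, 8)) (m : int) (v : fock) : fock :=
  \sum_p h p.1 p.2 *: heis_ij p m v.

Definition cplx (k : nat) (a : 'M[rat]_(k, 8)) : 'M[C]_(k, 8) := map_mx ratr a.

(* Coefficient of z^k in (\sum_(m >= 1) X_m z^m)^r, X_m operators. *)
Fixpoint series_pow (X : nat -> fock -> fock) (r k : nat) (v : fock) : fock :=
  match r with
  | 0 => if k == 0%N then v else 0
  | r'.+1 => \sum_(1 <= m < k.+1) X m (series_pow X r' (k - m) v)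
  end.

(* Coefficient of z^k in exp(\sum_(m >= 1) X_m z^m). *)
Definition series_exp (X : nat -> fock -> fock) (k : nat) (v : fock) : fock :=
  \sum_(0 <= r < k.+1) (r`!)%:R^-1 *: series_pow X r k v.

(* Coefficient of z^k in exp(\sum_(m >= 1) a(-m)/m z^m). *)
Definition E_minus (a : 'M[rat]_(n, 8)) : nat -> fock -> fock :=
  series_exp (fun m v => m%:R^-1 *: heis (cplx a) (- m%:Z) v).

(* Coefficient of z^-k in exp(- \sum_(m >= 1) a(m)/m z^-m). *)
Definition E_plus (a : 'M[rat]_(n, 8)) : nat -> fock -> fock :=
  series_exp (fun m v => - m%:R^-1 *: heis (cplx a) m%:Z v).

(* Coefficient of z^(-N-1) in
     Y(e^a, z) = exp(\sum a(-m)/m z^m) exp(- \sum a(m)/m z^-m) e^a z^a,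
   where e^a z^a (p (x) e^b) = eps(a,b) z^<a,b> (p (x) e^(a+b)).
   Here and below [\sum_(x \in A)] sums a family with finite support. *)
Definition Y_expo (a : 'M[rat]_(n, 8)) (N : int) : fock -> fock :=
  fock_lin (fun x =>
    \sum_(kl \in [set kl : nat * nat |
                   kl.1%:R - kl.2%:R + dot a x.2 = - N%:~R - 1])
      E_minus a kl.1 (E_plus a kl.2 (eps R B a x.2 *: ket x.1 (a + x.2)))).

(* Coefficient of z^(-N-1) in Y(x_1 ... x_r (x) e^a, z), which is the normally
   ordered product of the fields d^k/k! eps_ij(z), for x = ((i, j), k) in the
   list, and of Y(e^a, z).  The two sums are the creation part of
     d^k/k! h(z) = \sum_m binom(-m-1, k) h(m) z^(-m-1-k)
   (m = -j-1, placed on the left) and its annihilation part (m = j, placed on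
   the right). *)
Fixpoint Y_key (s : seq osc) (a : 'M[rat]_(n, 8)) (N : int) (v : fock) : fock :=
  match s with
  | [::] => Y_expo a N v
  | (p, k) :: s' =>
      \sum_(j \in [set: nat]) ('C(j, k))%:R *:
        heis_ij p (Negz j) (Y_key s' a (N + j%:Z - k%:Z) v) +
      \sum_(j \in [set: nat]) ((-1) ^+ k * ('C(j + k, k))%:R) *:
        Y_key s' a (N - j%:Z - k%:Z - 1) (heis_ij p (Posz j) v)
  end.

(* u_N v, where Y(u, z) = \sum_N u_N z^(-N-1). *)
Definition nprod (u : fock) (N : int) (v : fock) : fock :=
  \sum_(x <- msupp u) u@_x *: Y_key (enum_mset x.1) x.2 N v.

(* V_L = M(1) (x) C{L}, with M(1) the Heisenberg algebra of C (x) L. *)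
Definition lattice_VOA (L : set 'M[rat]_(n, 8)) : set fock :=
  smallest
    [set U | is_subspace U /\
       (forall (a : 'M[rat]_(n, 8)) (k : nat) (v : fock),
          L a -> U v -> U (heis (cplx a) (Negz k) v))]
    (expo @` L).

Definition weight (x : fock_key) : rat :=
  (\sum_(o <- enum_mset x.1) o.2.+1)%:R + dot x.2 x.2 / 2.

Definition weight_space (d : rat) : set fock :=
  [set v | forall x, x \in msupp v -> weight x = d].

(* No condition on a conformal vector: a subVOA may have a conformal vector
   other than that of [V], and the grading is the one of [V]. *)
Definition is_subVOA (V U : set fock) : Prop :=
  [/\ U `<=` V, is_subspace U, U vac
    & forall (u v : fock) (N : int), U u -> U v -> U (nprod u N v)].

Definition generated_subVOA (V S : set fock) : set fock :=
  smallest (is_subVOA V) S.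

(* The subalgebra of (W_2, u_1 v) generated by S. *)
Definition generated_Griess (W S : set fock) : set fock :=
  smallest
    [set U | [/\ U `<=` W `&` weight_space 2, is_subspace U
               & forall u v, U u -> U v -> U (nprod u 1 v)]] S.

(* omega_M for an orthonormal basis h of C (x) M. *)
Definition omega (d : nat) (h : 'I_d -> 'M[C]_(n, 8)) : fock :=
  2^-1 *: \sum_i heis (h i) (- 1) (heis (h i) (- 1) vac).

(* An orthonormal basis of C (x) M_alpha, M_alpha = Z alpha (x) E_8. *)
Definition Malpha_basis (alpha : 'rV[rat]_n) (j : 'I_8) : 'M[C]_(n, 8) :=
  (sqrtC 2)^-1 *: cplx (tens alpha (delta_mx 0 j)).

Lemma Malpha_basis_orthonormal (alpha : 'rV[rat]_n) (i j : 'I_8) :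
  dot alpha alpha = 2 ->
  dot (Malpha_basis alpha i) (Malpha_basis alpha j) = (i == j)%:R.
Proof.
move=> a2; rewrite /dot /Malpha_basis linearZ /= -scalemxAl -scalemxAr.
rewrite !linearZ /= map_trmx -map_mxM trace_map_mx /tens trmx_mul trmxK.
rewrite mulmxA -(mulmxA _ (delta_mx 0 i)) trmx_delta mul_delta_mx_cond.
have [_|_] := eqVneq i j; last first.
  by rewrite mulr0n mulmx0 mul0mx !linear0 rmorph0 !mulr0.
rewrite mulr1n mxtrace_mulC.
have -> : delta_mx (0 : 'I_1) (0 : 'I_1) = 1%:M :> 'M[rat]_1.
  by apply/matrixP=> x y; rewrite !mxE !ord1.
rewrite mulmx1 -/(dot alpha alpha) a2 mulrA -invfM -expr2 sqrtCK.
by rewrite rmorph_nat mulVf // pnatr_eq0.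
Qed.

Lemma Malpha_basis_span (alpha : 'rV[rat]_n) :
  lspan (range (Malpha_basis alpha)) =
  lspan [set cplx (tens alpha g) | g in latE8].
Proof.
have lspan_sub (S U : set 'M[C]_(n, 8)) :
    S `<=` lspan U -> lspan S `<=` lspan U.
  move=> SU; apply: smallest_sub => //; split=> [M [[M0 _] _]//|].
  by move=> c x y Ux Uy M MU; case: (MU) => [[_ MD] _]; apply: MD;
    [exact: Ux | exact: Uy].
have lspanZ (S : set 'M[C]_(n, 8)) c x : lspan S x -> lspan S (c *: x).
  move=> Sx M MS; have [[M0 MD] _] := MS.
  by rewrite -[_ *: _]addr0; apply: MD => //; exact: Sx.
have lspanS (S : set 'M[C]_(n, 8)) x : S x -> lspan S x by move=> Sx M [_]; apply.
have s2 : sqrtC 2 != 0 :> C by rewrite sqrtC_eq0 pnatr_eq0.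
apply/seteqP; split; apply: lspan_sub.
- move=> _ [j _ <-]; rewrite /Malpha_basis.
  have -> : cplx (tens alpha (delta_mx 0 j)) =
            2^-1 *: cplx (tens alpha (2 *: delta_mx 0 j)).
    rewrite /tens -scalemxAr /cplx map_mxZ rmorph_nat scalerA mulVf ?scale1r //.
    by rewrite pnatr_eq0.
  do 2!apply: (lspanZ); apply: lspanS; exists (2 *: delta_mx 0 j) => //.
  move=> M [_]; apply; left; split=> [i|].
    by rewrite !mxE -natrM natr_int.
  exists 1; rewrite (bigD1 j) //= big1 => [|i /negPf ij].
    by rewrite !mxE !eqxx addr0.
  by rewrite !mxE ij andbF mulr0.
- move=> _ [g _ <-]; rewrite [g]row_sum_delta.
  rewrite /tens mulmx_sumr /cplx raddf_sum /=.
  have sum0 : lspan (range (Malpha_basis alpha)) 0 by move=> M [[]].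
  elim/big_ind: _ => // [x y Sx Sy M MS|j _].
    have [[_ MD] _] := MS.
    by rewrite -[x]scale1r; apply: MD; [exact: Sx | exact: Sy].
  rewrite -scalemxAr map_mxZ; apply: (lspanZ).
  have -> : map_mx ratr (alpha^T *m delta_mx 0 j) =
            sqrtC 2 *: Malpha_basis alpha j.
    by rewrite /Malpha_basis scalerA divff // scale1r.
  by apply: (lspanZ); apply: lspanS; exists j.
Qed.

Definition ising (PE : {fset 'rV[rat]_8}) (alpha : 'rV[rat]_n) : fock :=
  16^-1 *: omega (Malpha_basis alpha) +
  32^-1 *: \sum_(beta <- PE)
             (expo (tens alpha beta) + expo (- tens alpha beta)).

Definition ising_vectors (P : {fset 'rV[rat]_n}) (PE : {fset 'rV[rat]_8}) :
    set fock :=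
  [set ising PE alpha | alpha in [set` P]].

Definition W_R (Q : set 'rV[rat]_n) (P : {fset 'rV[rat]_n})
    (PE : {fset 'rV[rat]_8}) : set fock :=
  generated_subVOA (lattice_VOA (tensor_E8 Q)) (ising_vectors P PE).

Definition G_R (Q : set 'rV[rat]_n) (P : {fset 'rV[rat]_n})
    (PE : {fset 'rV[rat]_8}) : set fock :=
  generated_Griess (W_R Q P PE) (ising_vectors P PE).

End LatticeVOA.

Arguments ising R {n} PE alpha.
Arguments ising_vectors R {n} P PE.
Arguments W_R R {n} B Q P PE.
Arguments G_R R {n} B Q P PE.

(* Main.v *)
Require Import Defs.
From HB Require Import structures.
From mathcomp Require Import all_boot all_order all_algebra.
From mathcomp Require Import finmap multiset complex.
From mathcomp Require Import boolp classical_sets fsbigop reals trigo monalg.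
From mathcomp Require Import zify ring lra.

Set Implicit Arguments.
Unset Strict Implicit.
Unset Printing Implicit Defensive.

Import Order.TTheory GRing.Theory Num.Theory.
Local Open Scope complex_scope.
Local Open Scope ring_scope.

(** The algebra generated by the Ising vectors is their span because the
    product of two of them is again a combination of Ising vectors, with a rule
    that depends only on the inner product of the two roots.  As e(-x) = e(x)
    and roots of R have inner products in {-2, ..., 2}, three cases suffice:
<<
      e(x)_1 e(x) = 2 e(x),
      e(x)_1 e(y) = 0                                      if <x,y> = 0,
      e(x)_1 e(y) = (e(x) + e(y) - e(x + y)) / 32          if <x,y> = -1.
>>
    In the last case x + y is again a root of R: the three Ising vectors span
    the Griess algebra of the 3C-algebra.

    Write e(x) = (1/64) q(x,x) + (1/32) E(x), where q(x,y) is the sum over j of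
    (x (x) eps_j)(-1) (y (x) eps_j)(-1) 1 and E(x) is the sum of e^{x (x) b}
    over the 240 roots b of E8.  The rule then follows from the products of
    quadratic oscillator states and exponentials, and from three facts.
    - The sum of b (x) b over the roots of E8 is 60 times the identity
      ([E8_roots_moment], read off from an explicit list of the roots).  Hence
      every root g has inner product 1 with exactly 56 roots ([Phi_count1]), so
      g is a sum of two roots in 56 ways ([big_Phi_add]).
    - e^a_1 e^b vanishes unless <a,b> <= -2, and for <a,b> = -2 it is a multiple
      of e^{a+b}.  For <x,y> = -1 this singles out the pairs x (x) b, y (x) b.
    - The cocycle is 1 on pairs x (x) b, x (x) c ([eps_tens_same]) and -1 on the
      pairs x (x) b, y (x) b with <x,y> = -1 ([eps_tens_opp]); the latter is
      the minus sign in front of e(x + y).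

    The computation is carried out once for abstract vectors subject to these
    product formulas ([mul_ising_elt_same], [mul_ising_elt_orth],
    [mul_ising_elt_adj]).  The formulas hold in the Fock space because the Ising
    vectors involve only oscillators of degree one: for a = 0 the normally
    ordered products collapse to [quad_mode] ([Y_key_quad]), and each
    coefficient of the annihilation series reduces to a power of a(1)
    ([E_plus_tame]).

    The Griess algebra is therefore contained in the span ([span_closed]), the
    span having weight 2 and lying in W_R, which is an intersection of
    subspaces containing the generators ([G_R_span]).

    For the dimension, x (x) b determines the pair (x,b) up to a common sign,
    so for positive roots x and y the coefficient of e^{y (x) b} in e(x) is
    1/32 if x = y and 0 otherwise ([mcoeff_positive]): the Ising vectors are
    linearly independent. *)

(** * Spans, the standard form and tensors *)

Section LinearSpans.

Variables (F : fieldType) (V : lmodType F) (S : set V).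

Lemma lspan_subspace : is_subspace (lspan S).
Proof.
split=> [U [[U0 _] _]//|c x y Sx Sy U US].
by case: (US) => [[_ UD] _]; apply: UD; [exact: Sx|exact: Sy].
Qed.

Lemma sub_lspan : (S `<=` lspan S)%classic.
Proof. exact: sub_smallest. Qed.

Lemma lspan_min (U : set V) :
  is_subspace U -> (S `<=` U)%classic -> (lspan S `<=` U)%classic.
Proof. by move=> Us SU; apply: smallest_sub. Qed.

Lemma lspanZ c x : lspan S x -> lspan S (c *: x).
Proof.
move=> Sx; rewrite -[_ *: x]addr0; apply: lspan_subspace.2 => //.
exact: lspan_subspace.1.
Qed.

Lemma lspanD x y : lspan S x -> lspan S y -> lspan S (x + y).
Proof. by move=> Sx Sy; rewrite -[x]scale1r; apply: lspan_subspace.2. Qed.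

End LinearSpans.

Lemma zspan_min (V : zmodType) (S G : set V) : G 0 ->
  (forall x y, G x -> G y -> G (x - y)) -> (S `<=` G)%classic ->
  (zspan S `<=` G)%classic.
Proof. by move=> G0 GB SG; apply: smallest_sub. Qed.

Lemma zspan_sub (V : zmodType) (S : set V) : (S `<=` zspan S)%classic.
Proof. exact: sub_smallest. Qed.

Lemma zspan0 (V : zmodType) (S : set V) : zspan S 0.
Proof. by move=> G [[]]. Qed.

Lemma zspanB (V : zmodType) (S : set V) x y :
  zspan S x -> zspan S y -> zspan S (x - y).
Proof.
move=> Sx Sy G GS; case: (GS) => [[_ GB] _].
by apply: GB; [apply: Sx|apply: Sy].
Qed.

Lemma dotE (F : fieldType) (m1 m2 : nat) (A B : 'M[F]_(m1, m2)) :
  dot A B = \sum_p A p.1 p.2 * B p.1 p.2.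
Proof.
rewrite /dot /mxtrace.
under eq_bigr => i _.
  rewrite mxE; under eq_bigr => j _ do rewrite [B^T _ _]mxE.
  over.
exact: (pair_bigA _ (fun i j => A i j * B i j)).
Qed.

Lemma dot0l (F : fieldType) (m1 m2 : nat) (A : 'M[F]_(m1, m2)) : dot 0 A = 0.
Proof. by rewrite /dot mul0mx linear0. Qed.

Lemma dot0r (F : fieldType) (m1 m2 : nat) (A : 'M[F]_(m1, m2)) : dot A 0 = 0.
Proof. by rewrite /dot trmx0 mulmx0 linear0. Qed.

Lemma dot_rV (n : nat) (a b : 'rV[rat]_n) : dot a b = \sum_i a 0 i * b 0 i.
Proof. by rewrite /dot /mxtrace big_ord1 mxE; under eq_bigr do rewrite mxE. Qed.

Lemma dotC (F : fieldType) (m n : nat) (a b : 'M[F]_(m, n)) : dot a b = dot b a.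
Proof. by rewrite /dot -mxtrace_tr trmx_mul trmxK. Qed.

Lemma dotDl (F : fieldType) (m n : nat) (a b c : 'M[F]_(m, n)) :
  dot (a + b) c = dot a c + dot b c.
Proof. by rewrite /dot mulmxDl linearD. Qed.

Lemma dotNl (F : fieldType) (m n : nat) (a b : 'M[F]_(m, n)) :
  dot (- a) b = - dot a b.
Proof. by rewrite /dot mulNmx linearN. Qed.

Lemma dotDr (F : fieldType) (m n : nat) (a b c : 'M[F]_(m, n)) :
  dot c (a + b) = dot c a + dot c b.
Proof. by rewrite dotC dotDl !(dotC c). Qed.

Lemma dotNr (F : fieldType) (m n : nat) (a b : 'M[F]_(m, n)) :
  dot b (- a) = - dot b a.
Proof. by rewrite dotC dotNl dotC. Qed.

Lemma dotZl (F : fieldType) (m n : nat) (k : F) (a b : 'M[F]_(m, n)) :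
  dot (k *: a) b = k * dot a b.
Proof. by rewrite /dot -scalemxAl linearZ. Qed.

Lemma dotZr (F : fieldType) (m n : nat) (k : F) (a b : 'M[F]_(m, n)) :
  dot a (k *: b) = k * dot a b.
Proof. by rewrite dotC dotZl dotC. Qed.

Lemma dot_ge0 n (a : 'rV[rat]_n) : 0 <= dot a a.
Proof. by rewrite dot_rV sumr_ge0 // => i _; rewrite -expr2 sqr_ge0. Qed.

Lemma dot_eq0 n (a : 'rV[rat]_n) : dot a a = 0 -> a = 0.
Proof.
rewrite dot_rV => /eqP; rewrite psumr_eq0 => [/allP a0|i _]; last first.
  by rewrite -expr2 sqr_ge0.
apply/rowP => i; have := a0 i (mem_index_enum _).
by rewrite mulf_eq0 orbb mxE => /eqP.
Qed.

(** Equality in the Cauchy-Schwarz inequality: [dot (a - b) (a - b)] is 0. *)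
Lemma norm2_eq n (a b : 'rV[rat]_n) : dot a a = 2 -> dot b b = 2 ->
  dot a b = 2 -> a = b.
Proof.
move=> aa bb ab; apply/eqP; rewrite -subr_eq0; apply/eqP/dot_eq0.
by rewrite dotDl !dotDr !dotNl !dotNr aa bb (dotC b) ab; lra.
Qed.

Lemma norm2_opp n (a b : 'rV[rat]_n) : dot a a = 2 -> dot b b = 2 ->
  dot a b = -2 -> b = - a.
Proof.
move=> aa bb ab; apply: norm2_eq => //; first by rewrite dotNl dotNr opprK.
by rewrite dotNr dotC ab opprK.
Qed.

(** Cauchy-Schwarz, from the squared lengths of [a + b] and [a - b]. *)
Lemma norm2_bound n (a b : 'rV[rat]_n) : dot a a = 2 -> dot b b = 2 ->
  dot a b \is a Num.int -> dot a b \in [:: -2; -1; 0; 1; 2].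
Proof.
move=> aa bb /intrP[k abk].
have h1 := dot_ge0 (a + b); have h2 := dot_ge0 (a - b).
rewrite !(dotDl, dotDr, dotNl, dotNr) aa bb (dotC b) abk in h1 h2.
have k1 : -2 <= k by rewrite -(ler_int rat) rmorphN /=; lra.
have k2 : k <= 2 by rewrite -(ler_int rat) /=; lra.
have : k \in [:: -2; -1; 0; 1; 2] by rewrite !inE; lia.
by rewrite abk !inE => /or4P[/eqP->|/eqP->|/eqP->|/orP[]/eqP->].
Qed.

Lemma dot_tens n (x y : 'rV[rat]_n) (u v : 'rV[rat]_8) :
  dot (tens x u) (tens y v) = dot x y * dot u v.
Proof.
rewrite {1}/dot /tens trmx_mul trmxK mulmxA -(mulmxA x^T).
have -> : u *m v^T = (dot u v)%:M.
  by rewrite [LHS]mx11_scalar /dot /mxtrace big_ord1.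
rewrite mul_mx_scalar -scalemxAl linearZ /= mxtrace_mulC mulrC.
by rewrite (dotC x).
Qed.

Lemma tensDl n (x y : 'rV[rat]_n) u : tens (x + y) u = tens x u + tens y u.
Proof. by rewrite /tens linearD mulmxDl. Qed.
Lemma tensNl n (x : 'rV[rat]_n) u : tens (- x) u = - tens x u.
Proof. by rewrite /tens linearN mulNmx. Qed.
Lemma tensDr n (x : 'rV[rat]_n) u v : tens x (u + v) = tens x u + tens x v.
Proof. by rewrite /tens mulmxDr. Qed.
Lemma tensNr n (x : 'rV[rat]_n) u : tens x (- u) = - tens x u.
Proof. by rewrite /tens mulmxN. Qed.

Lemma dot_map (F : numFieldType) n m (a b : 'M[rat]_(n, m)) :
  dot (map_mx ratr a : 'M[F]_(n, m)) (map_mx ratr b) = ratr (dot a b).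
Proof. by rewrite /dot map_trmx -map_mxM trace_map_mx. Qed.

Lemma dot_delta (F : fieldType) n (u : 'rV[F]_n) j : dot u (delta_mx 0 j) = u 0 j.
Proof.
rewrite /dot trmx_delta /mxtrace big_ord1 mxE (bigD1 j) //= big1 => [|i /negPf ij].
  by rewrite mxE !eqxx mulr1 addr0.
by rewrite mxE ij mulr0.
Qed.

(** * The root system of E8 *)

Fixpoint words (vals : seq int) (k : nat) : seq (seq int) :=
  if k is k'.+1 then [seq x :: s | x <- vals, s <- words vals k'] else [:: [::]].

Lemma mem_words vals k s :
  (s \in words vals k) = (size s == k) && all [in vals] s.
Proof.
elim: k s => [|k IHk] s /=; first by rewrite inE; case: s.
apply/allpairsP/andP => [[[x t] /= [xv + ->]]|[]] /=.
  by rewrite IHk eqSS xv => /andP[-> ->].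
case: s => //= x t; rewrite eqSS => tk /andP[xv tv].
by exists (x, t); split => //; rewrite IHk tk.
Qed.

Definition isum (s : seq int) := foldr +%R 0 s.
Definition inorm (s : seq int) := foldr (fun x a => x * x + a) 0 s.

(** Twice the roots of E8: integer words of norm 8 with entry sum divisible by
    4, either all even or all odd.  The doubling makes the list computable. *)
Definition E8_words : seq (seq int) :=
  [seq s <- words [:: -2; 0; 2] 8 ++ words [:: -1; 1] 8 |
     (inorm s == 8) && (4 %| isum s)%Z].

Definition moment i j :=
  foldr (fun s a => nth 0 s i * nth 0 s j + a) 0 E8_words.

Lemma uniq_E8_words : uniq E8_words.
Proof. by vm_compute. Qed.

(** The entries are doubled, so this is 4 times the second moment 60 of the
    roots of E8. *)
Lemma E8_moments : all (fun i => all (fun j =>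
  moment i j == if i == j then 240 else 0) (iota 0 8)) (iota 0 8).
Proof. by vm_compute. Qed.

Definition half_vec (s : seq int) : 'rV[rat]_8 := \row_j ((nth 0 s j)%:~R / 2).

Lemma half_vec_inj : {in [pred s : seq int | size s == 8%N] &, injective half_vec}.
Proof.
move=> s t; rewrite !inE => /eqP s8 /eqP t8 /rowP st.
apply: (@eq_from_nth _ 0); first by rewrite s8.
move=> i; rewrite s8 => i8; have := st (Ordinal i8); rewrite !mxE /=.
by move=> /(divIf _) /eqP; rewrite pnatr_eq0 eqr_int => /(_ isT) /eqP.
Qed.

Lemma nth_big (s : seq int) (F : int -> rat) : size s = 8%N ->
  \sum_(i < 8) F (nth 0 s i) = \sum_(x <- s) F x.
Proof. by move=> s8; rewrite [RHS](big_nth 0) s8 big_mkord. Qed.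

Lemma isumE s : isum s = \sum_(x <- s) x.
Proof. by rewrite unlock. Qed.

Lemma inormE s : inorm s = \sum_(x <- s) x * x.
Proof. by rewrite unlock. Qed.

(** The vectors of this form are stable under subtraction and include the
    generators. *)
Lemma latE8_decomp v : latE8 v ->
  exists u (m : int), latD u /\ v = u + m%:~R *: half_ones.
Proof.
move: v; apply: zspan_min.
- exists 0, 0; rewrite scale0r addr0; split=> //; split=> [i|].
    by rewrite mxE.
  by exists 0; rewrite big1 ?mulr0 // => i _; rewrite mxE.
- move=> _ _ [u [m [[uZ [k uk]] ->]]] [w [l [[wZ [k' wk]] ->]]].
  exists (u - w), (m - l); split; last first.
    by rewrite rmorphB /= scalerBl opprD addrACA.
  split=> [i|]; first by rewrite !mxE rpredB.
  exists (k - k'); rewrite rmorphB mulrBr -uk -wk -sumrB.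
  by apply: eq_bigr => i _; rewrite !mxE.
- move=> v [vD|->]; first by exists v, 0; rewrite scale0r addr0.
  exists 0, 1; rewrite scale1r add0r; split=> //; split=> [i|].
    by rewrite mxE.
  by exists 0; rewrite big1 ?mulr0 // => i _; rewrite mxE.
Qed.

Lemma latE8_dot_int v w : latE8 v -> latE8 w -> dot v w \is a Num.int.
Proof.
move=> /latE8_decomp[u [m [[uZ [k uk]] ->]]] /latE8_decomp[t [l [[tZ [k' tk]] ->]]].
have -> : dot (u + m%:~R *: half_ones) (t + l%:~R *: half_ones) =
   \sum_i u 0 i * t 0 i + (l * k + m * k' + 2 * (m * l))%:~R.
  rewrite dot_rV (_ : \sum_i _ = \sum_i (u 0 i * t 0 i + l%:~R / 2 * u 0 i +
      m%:~R / 2 * t 0 i + m%:~R * l%:~R / 4)); last first.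
    by apply: eq_bigr => i _; rewrite !mxE; field.
  rewrite !big_split /= -!mulr_sumr uk tk sumr_const card_ord -mulr_natr.
  by rewrite !(rmorphD, rmorphM) /=; field.
by rewrite rpredD ?rpred_int // rpred_sum // => i _; rewrite rpredM.
Qed.

Lemma latE8_double v i : latE8 v -> 2 * v 0 i \is a Num.int.
Proof.
move=> /latE8_decomp[u [m [[uZ _] ->]]]; rewrite !mxE mulrDr mulrCA mul1r.
by rewrite divff // mulr1 rpredD ?rpredM ?rpred_int ?rpred_nat.
Qed.

Lemma E8_words_entries s : s \in E8_words ->
  size s = 8%N /\ ((forall i, (i < 8)%N -> nth 0 s i \in [:: -2; 0; 2]) \/
                   (forall i, (i < 8)%N -> nth 0 s i \in [:: -1; 1])).
Proof.
rewrite mem_filter mem_cat !mem_words => /andP[_ /orP[]] /andP[/eqP s8 /allP sv].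
  by split=> //; left=> i i8; apply: sv; rewrite mem_nth ?s8.
by split=> //; right=> i i8; apply: sv; rewrite mem_nth ?s8.
Qed.

Lemma half_vec_root s : s \in E8_words -> Defs.roots latE8 (half_vec s).
Proof.
move=> sE; have [s8 sv] := E8_words_entries sE.
move: sE; rewrite mem_filter => /andP[/andP[/eqP n8 /dvdzP[k sk]] _].
have sumE : \sum_i half_vec s 0 i = 2 * k%:~R.
  rewrite (_ : \sum_i _ = \sum_(i < 8) ((nth 0 s i)%:~R / 2)); last first.
    by apply: eq_bigr => i _; rewrite mxE.
  rewrite (nth_big (fun x => x%:~R / 2)) // -mulr_suml -rmorph_sum -isumE sk.
  by rewrite rmorphM /=; field.
split; last first.
  rewrite dot_rV (_ : \sum_i _ = \sum_(i < 8) (((nth 0 s i) * (nth 0 s i))%:~R / 4)).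
    rewrite (nth_big (fun x => (x * x)%:~R / 4)) // -mulr_suml -rmorph_sum.
    by rewrite -inormE n8; field.
  by apply: eq_bigr => i _; rewrite !mxE rmorphM /=; field.
case: sv => sv.
  apply: zspan_sub; left; split=> [i|]; last by exists k.
  rewrite mxE; have := sv i (ltn_ord i); rewrite !inE => /or3P[] /eqP-> //.
(* An odd word is a vector of D8 plus [half_ones]. *)
rewrite -[half_vec s](subrK half_ones) -[X in latE8 (_ + X)]opprK.
apply: zspanB; last first.
  by rewrite -sub0r; apply: zspanB; [exact: zspan0|apply: zspan_sub; right].
apply: zspan_sub; left; split=> [i|].
  rewrite !mxE; have := sv i (ltn_ord i); rewrite !inE => /orP[] /eqP-> //.
exists (k - 2); rewrite (_ : \sum_i _ = \sum_i half_vec s 0 i - \sum_(i < 8) (1/2)).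
  by rewrite sumE sumr_const card_ord rmorphB /=; field.
by rewrite -sumrB; apply: eq_bigr => i _; rewrite !mxE.
Qed.

(** Twice a vector of E8 has entries of a common parity and entry sum divisible
    by 4.  Norm 2 makes the squares of these entries add up to 8, which leaves
    only entries 0, 2, -2 or entries 1, -1. *)
Lemma root_half_vec v :
  Defs.roots latE8 v -> exists2 s, s \in E8_words & v = half_vec s.
Proof.
move=> [vE v2].
have vZ i : 2 * v 0 i \is a Num.int by exact: latE8_double.
pose s := mkseq (fun i => Num.floor (2 * v 0 (inord i))) 8.
have s8 : size s = 8%N by rewrite size_mkseq.
have sE (i : 'I_8) : (nth 0 s i)%:~R = 2 * v 0 i.
  by rewrite nth_mkseq // inord_val floorK.
have vs : v = half_vec s.
  by apply/rowP => i; rewrite mxE sE; field.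
clearbody s; exists s => //.
have n8 : inorm s = 8.
  apply/eqP; rewrite -(eqr_int rat) inormE rmorph_sum.
  rewrite -(nth_big (fun x => (x * x)%:~R)) //.
  rewrite (_ : \sum_i _ = \sum_(i < 8) 4 * (v 0 i * v 0 i)).
    by rewrite -mulr_sumr -dot_rV v2; apply/eqP; field.
  by apply: eq_bigr => i _; rewrite rmorphM /= sE; field.
have [u [m [[uZ [k uk]] vu]]] := latE8_decomp vE.
have sm : isum s = 4 * (k + 2 * m).
  apply/eqP; rewrite -(eqr_int rat) isumE rmorph_sum.
  rewrite -(nth_big (fun x => x%:~R)) //.
  rewrite (_ : \sum_i _ = \sum_(i < 8) (2 * u 0 i + m%:~R)).
    rewrite big_split /= -mulr_sumr uk sumr_const card_ord.
    by rewrite !(rmorphM, rmorphD) /= -mulr_natr; apply/eqP; field.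
  by apply: eq_bigr => i _; rewrite sE vu !mxE; field.
rewrite mem_filter n8 sm mem_cat !mem_words s8 /= dvdz_mulr //=.
have le8 x : x \in s -> x * x <= 8.
  move=> xs; rewrite -n8 inormE (big_rem x) //= lerDl sumr_ge0 // => y _.
  by rewrite -expr2 sqr_ge0.
have par (i : 'I_8) : exists j : int, nth 0 s i = 2 * j + m.
  have /intrP[j uj] := uZ i; exists j; apply/eqP; rewrite -(eqr_int rat) sE vu.
  by rewrite !mxE uj !(rmorphM, rmorphD) /=; apply/eqP; field.
have par' x : x \in s -> exists j : int, x = 2 * j + m.
  by case/(nthP 0) => i; rewrite s8 => i8 <-; exact: (par (Ordinal i8)).
have small x : x \in s -> x \in [:: -2; -1; 0; 1; 2].
  move=> xs; have xx := le8 x xs; rewrite !inE.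
  have : -2 <= x <= 2 by nia.
  by lia.
case: (boolP (2 %| m)%Z) => [/dvdzP[m' mm]|m2]; apply/orP; [left|right].
  apply/allP => x xs; have [j xj] := par' x xs.
  by move: (small x xs); rewrite !inE; lia.
have m2' : m = 2 * (m %/ 2)%Z + 1.
  have := divz_eq m 2; have := modz_ge0 m (isT : 2 != 0 :> int).
  have := ltz_pmod m (isT : 0 < 2 :> int).
  by move/dvdz_mod0P: m2; lia.
apply/allP => x xs; have [j xj] := par' x xs.
by move: (small x xs); rewrite !inE; lia.
Qed.

Local Opaque E8_words.

(** Sealed, so that the list of 240 vectors is not unfolded in comparisons. *)
HB.lock Definition E8_roots : seq 'rV[rat]_8 := [seq half_vec s | s <- E8_words].

Lemma mem_E8_roots v : v \in E8_roots <-> Defs.roots latE8 v.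
Proof.
rewrite unlock; split=> [/mapP[s sE ->]|/root_half_vec[s sE ->]].
  exact: half_vec_root.
exact: map_f.
Qed.

Lemma uniq_E8_roots : uniq E8_roots.
Proof.
rewrite unlock map_inj_in_uniq; first exact: uniq_E8_words.
move=> s t /E8_words_entries[s8 _] /E8_words_entries[t8 _].
by apply: half_vec_inj; rewrite inE; apply/eqP.
Qed.

Lemma E8_roots_moment (i j : 'I_8) :
  \sum_(v <- E8_roots) v 0 i * v 0 j = if i == j then 60 else 0.
Proof.
rewrite [E8_roots]unlock big_map (_ : \sum_(s <- _) _ = (moment i j)%:~R / 4).
  have /allP/(_ i) := E8_moments; rewrite mem_iota ltn_ord => /(_ isT).
  move=> /allP/(_ j); rewrite mem_iota ltn_ord => /(_ isT) /eqP ->.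
  by rewrite -[val i == val j]/(i == j); case: eqP.
have -> : moment i j = \sum_(s <- E8_words) nth 0 s i * nth 0 s j.
  by rewrite unlock.
rewrite rmorph_sum mulr_suml; apply: eq_bigr => s _.
by rewrite !mxE rmorphM /=; field.
Qed.

Section E8count.

Local Notation Phi := E8_roots.

Lemma Phi_norm b : b \in Phi -> dot b b = 2.
Proof. by case/mem_E8_roots. Qed.

Lemma Phi_lat b : b \in Phi -> latE8 b.
Proof. by case/mem_E8_roots. Qed.

Lemma latE8N b : latE8 b -> latE8 (- b).
Proof. by move=> bE; rewrite -sub0r; apply: zspanB => //; exact: zspan0. Qed.

Lemma latE8D a b : latE8 a -> latE8 b -> latE8 (a + b).
Proof. by move=> aE bE; rewrite -[b]opprK; apply: zspanB => //; exact: latE8N. Qed.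

Lemma Phi_opp b : (- b \in Phi) = (b \in Phi).
Proof.
suff N x : x \in Phi -> - x \in Phi by apply/idP/idP => /N; rewrite ?opprK.
move=> xP; apply/mem_E8_roots; split.
  by apply: latE8N; apply: Phi_lat.
by rewrite dotNl dotNr opprK Phi_norm //.
Qed.

Lemma Phi_dot a b : a \in Phi -> b \in Phi -> dot a b \in [:: -2; -1; 0; 1; 2].
Proof.
by move=> aP bP; apply: norm2_bound; rewrite ?Phi_norm ?latE8_dot_int //;
  exact: Phi_lat.
Qed.

Lemma Phi_add a b : a \in Phi -> b \in Phi -> dot a b = -1 -> a + b \in Phi.
Proof.
move=> aP bP ab; apply/mem_E8_roots; split.
  by apply: latE8D; exact: Phi_lat.
by rewrite dotDl !dotDr (dotC b) ab !Phi_norm //; lra.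
Qed.

Lemma big_Phi_opp (V : nmodType) (F : 'rV[rat]_8 -> V) :
  \sum_(b <- Phi) F (- b) = \sum_(b <- Phi) F b.
Proof.
rewrite -(big_map (fun b => - b) xpredT F); apply: perm_big.
apply: uniq_perm; rewrite ?uniq_E8_roots //.
  by rewrite map_inj_uniq ?uniq_E8_roots //; exact: oppr_inj.
move=> b; apply/mapP/idP => [[c cP ->]|bP]; first by rewrite Phi_opp.
by exists (- b); rewrite ?Phi_opp ?opprK.
Qed.

(** The second moment of a root system is a multiple of the form. *)
Lemma Phi_dot_sq (g : 'rV[rat]_8) : \sum_(b <- Phi) dot b g ^+ 2 = 60 * dot g g.
Proof.
under eq_bigr => b _ do rewrite expr2 !dot_rV big_distrlr /=.
rewrite exchange_big dot_rV mulr_sumr; apply: eq_bigr => i _.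
rewrite exchange_big (bigD1 i) //= [X in _ + X]big1 => [|j ji].
  rewrite addr0; transitivity (\sum_(b <- Phi) b 0 i * b 0 i * (g 0 i * g 0 i)).
    by apply: eq_bigr => b _; rewrite mulrACA.
  by rewrite -mulr_suml E8_roots_moment eqxx.
transitivity (\sum_(b <- Phi) b 0 i * b 0 j * (g 0 i * g 0 j)).
  by apply: eq_bigr => b _; rewrite mulrACA.
by rewrite -mulr_suml E8_roots_moment eq_sym (negPf ji) mul0r.
Qed.

(** Summing the squares of all [dot b g] gives 120.  The roots [g] and [- g]
    contribute 8, and those of inner product 1 and -1, equally many by
    symmetry, contribute 1 each: hence 120 = 8 + 2 * 56. *)
Lemma Phi_count1 g : g \in Phi -> count (fun b => dot b g == 1) Phi = 56%N.
Proof.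
move=> gP; have := Phi_dot_sq g; rewrite (Phi_norm gP).
have -> : \sum_(b <- Phi) dot b g ^+ 2 =
  \sum_(b <- Phi) (4 * (b == g)%:R + 4 * (- b == g)%:R +
                   (dot b g == 1)%:R + (dot (- b) g == 1)%:R) :> rat.
  rewrite big_seq [RHS]big_seq; apply: eq_bigr => b bP; rewrite dotNl.
  have bg : (b == g) = (dot b g == 2).
    apply/eqP/eqP => [->|bg]; first exact: Phi_norm.
    by apply: norm2_eq => //; exact: Phi_norm.
  have bNg : (- b == g) = (dot b g == -2).
    apply/eqP/eqP => [<-|bNg]; first by rewrite dotNr Phi_norm.
    by apply/esym/norm2_opp => //; exact: Phi_norm.
  rewrite bg bNg; have := Phi_dot bP gP; rewrite !inE.
  by case/or4P=> [/eqP->|/eqP->|/eqP->|/orP[]/eqP->].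
rewrite !big_split /= -!mulr_sumr.
rewrite (big_Phi_opp (fun b => (dot b g == 1)%:R)).
rewrite (big_Phi_opp (fun b => (b == g)%:R)).
have -> : \sum_(b <- Phi) (b == g)%:R = 1 :> rat.
  by rewrite -natr_sum -big_mkcond sum1_count count_uniq_mem ?uniq_E8_roots ?gP.
rewrite -natr_sum -big_mkcond sum1_count /= => E; apply/eqP.
by rewrite -(eqr_nat rat); apply/eqP; lra.
Qed.

(** For fixed [a], translation by [a] maps the roots of inner product -1 with
    [a] onto those of inner product 1, so each root [g] is reached once for
    each of the 56 roots [a] with [dot a g = 1]. *)
Lemma big_Phi_add (F : fieldType) (V : lmodType F) (f : 'rV[rat]_8 -> V) :
  \sum_(a <- Phi) \sum_(b <- Phi | dot a b == -1) f (a + b) =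
  56%:R *: \sum_(g <- Phi) f g.
Proof.
have step a : a \in Phi -> \sum_(b <- Phi | dot a b == -1) f (a + b) =
    \sum_(g <- Phi | dot a g == 1) f g.
  move=> aP; rewrite -!(big_filter Phi).
  rewrite -(big_map (fun b => a + b) xpredT f); apply: perm_big.
  apply: uniq_perm; rewrite ?filter_uniq ?uniq_E8_roots //.
    by rewrite map_inj_uniq ?filter_uniq ?uniq_E8_roots //; exact: addrI.
  move=> g; apply/mapP/idP => [[b]|].
    rewrite !mem_filter => /andP[/eqP ab bP] ->.
    by rewrite Phi_add // dotDr ab Phi_norm.
  rewrite mem_filter => /andP[/eqP ag gP]; exists (g - a); last by rewrite addrC subrK.
  rewrite mem_filter dotDr dotNr ag Phi_norm // [g - a]addrC.
  rewrite Phi_add ?Phi_opp ?dotNl ?ag //.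
rewrite big_seq (eq_bigr _ step) -big_seq.
under eq_bigr => a _ do rewrite big_mkcond.
rewrite exchange_big scaler_sumr big_seq [RHS]big_seq; apply: eq_bigr => g gP.
rewrite -big_mkcond /= -(Phi_count1 gP) big_const_seq iter_addr_0 scaler_nat.
by [].
Qed.

End E8count.

(** * The root lattices and the cocycle *)

(** What the proof uses of a root lattice. *)
Definition half_integral_lattice n (Q : set 'rV[rat]_n) : Prop :=
  [/\ forall x y, Q x -> Q y -> Q (x - y),
      forall x y, Q x -> Q y -> dot x y \is a Num.int
    & forall x i, Q x -> 2 * x 0 i \is a Num.int].

Lemma dot_int n (x y : 'rV[rat]_n) :
  (forall i, x 0 i \is a Num.int) -> (forall i, y 0 i \is a Num.int) ->
  dot x y \is a Num.int.
Proof. by move=> xZ yZ; rewrite dot_rV rpred_sum // => i _; rewrite rpredM. Qed.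

(** All five families lie in some Z^n or in E8, and are cut out there by
    conditions stable under subtraction. *)
Lemma root_lattice_half_integral n (Q : set 'rV[rat]_n) :
  is_root_lattice Q -> half_integral_lattice Q.
Proof.
have sumB (k : nat) (x y : 'rV[rat]_k) :
    \sum_i (x - y) 0 i = \sum_i x 0 i - \sum_i y 0 i.
  by rewrite -sumrB; apply: eq_bigr => i _; rewrite !mxE.
case=> {n Q} [n _|n _|||].
- split=> [x y [xZ x0] [yZ y0]|x y [xZ _] [yZ _]|x i [xZ _]].
  + split=> [i|]; first by rewrite !mxE rpredB.
    by rewrite sumB x0 y0 subrr.
  + exact: dot_int.
  + by rewrite rpredM.
- split=> [x y [xZ [k xk]] [yZ [l yl]]|x y [xZ _] [yZ _]|x i [xZ _]].
  + split=> [i|]; first by rewrite !mxE rpredB.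
    by exists (k - l); rewrite sumB xk yl rmorphB mulrBr.
  + exact: dot_int.
  + by rewrite rpredM.
- split=> [x y [[xE x7] x6] [[yE y7] y6]|x y [[xE _] _] [[yE _] _]|x i [[xE _] _]].
  + do !split; first exact: zspanB.
      by rewrite dotDl dotNl x7 y7 subrr.
    by rewrite dotDl dotNl x6 y6 subrr.
  + exact: latE8_dot_int.
  + exact: latE8_double.
- split=> [x y [xE x7] [yE y7]|x y [xE _] [yE _]|x i [xE _]].
  + split; first exact: zspanB.
    by rewrite dotDl dotNl x7 y7 subrr.
  + exact: latE8_dot_int.
  + exact: latE8_double.
- split=> [x y xE yE|x y xE yE|x i xE].
  + exact: zspanB.
  + exact: latE8_dot_int.
  + exact: latE8_double.
Qed.

Section LatticeOps.

Variables (n : nat) (Q : set 'rV[rat]_n).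
Hypothesis Qh : half_integral_lattice Q.

Lemma latB x y : Q x -> Q y -> Q (x - y).
Proof. by case: Qh => + _ _; apply. Qed.

Lemma lat_opp x : Q x -> Q (- x).
Proof. by move=> Qx; rewrite -sub0r -[0](subrr x); apply: latB (latB _ _) _. Qed.

Lemma lat_add x y : Q x -> Q y -> Q (x + y).
Proof. by move=> Qx Qy; rewrite -[y]opprK; apply: latB => //; exact: lat_opp. Qed.

Lemma roots_opp x : Defs.roots Q x -> Defs.roots Q (- x).
Proof.
by move=> [Qx x2]; split; [exact: lat_opp | rewrite dotNl dotNr opprK].
Qed.

Lemma roots_add x y : Defs.roots Q x -> Defs.roots Q y -> dot x y = -1 ->
  Defs.roots Q (x + y).
Proof.
move=> [Qx x2] [Qy y2] xy; split; first exact: lat_add.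
by rewrite dotDl !dotDr (dotC y) xy x2 y2; lra.
Qed.

Lemma roots_dot x y : Defs.roots Q x -> Defs.roots Q y ->
  dot x y \in [:: -2; -1; 0; 1; 2].
Proof.
by move=> [Qx x2] [Qy y2]; apply: norm2_bound => //; case: Qh => _ + _; apply.
Qed.

End LatticeOps.

Section Cocycle.

Variables (R : realType) (B : 'M[rat]_8).
Hypothesis HB : root_basis_E8 B.

Lemma basis_unit : B \in unitmx.
Proof. by case: HB => _; rewrite row_free_unit. Qed.

Lemma latE8_coord v : latE8 v ->
  exists b : 'I_8 -> int, v = \sum_j (b j)%:~R *: row j B.
Proof.
case: HB => _ _ <-; move: v; apply: zspan_min.
- by exists (fun _ => 0); rewrite big1 // => j _; rewrite scale0r.
- move=> _ _ [b ->] [c ->]; exists (fun j => b j - c j).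
  by rewrite -sumrB; apply: eq_bigr => j _; rewrite rmorphB scalerBl.
- move=> _ [j _ <-]; exists (fun i => (i == j)%:R).
  rewrite (bigD1 j) //= eqxx scale1r big1 ?addr0 // => i /negPf ij.
  by rewrite ij scale0r.
Qed.

(** The coordinates are relative to the halves of the basis vectors, whence the
    factor 2 in the hypothesis. *)
Lemma half_coordE (c : int) (b : 'I_8 -> int) (a : 'rV[rat]_8) i :
  2 *: a = c%:~R *: \sum_j (b j)%:~R *: row j B ->
  half_coord B a i = c * b i.
Proof.
move=> aE; rewrite /half_coord.
suff -> : a *m invmx (2^-1 *: B) = \row_j (c * b j)%:~R.
  by rewrite mxE intrKfloor.
have uB : 2^-1 *: B \in unitmx by rewrite unitmxZ ?basis_unit // unitfE.
suff -> : a = (\row_j (c * b j)%:~R) *m (2^-1 *: B) by rewrite mulmxK.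
rewrite -scalemxAr.
apply: (@scalerI _ _ (2 : rat)) => //; rewrite aE scalerA divff // scale1r.
rewrite mulmx_sum_row scaler_sumr; apply: eq_bigr => j _.
by rewrite scalerA mxE rmorphM.
Qed.

(** A quarter of the exponent of the cocycle, on coordinate vectors relative to
    the basis of E8. *)
Definition cocycle_form (b c : 'I_8 -> int) : int :=
  \sum_i \sum_j b i * c j * eps0_basis B i j.

(** Row [i] of [tens x v] is [x 0 i] times [v], with coordinates [2 * x 0 i]
    times those of [v]; summing over the rows produces four times [dot x y]. *)
Lemma eps0_tens n (x y : 'rV[rat]_n) (k : int) (b c : 'I_8 -> int) :
  (forall i, 2 * x 0 i \is a Num.int) -> (forall i, 2 * y 0 i \is a Num.int) ->
  dot x y = k%:~R ->
  eps0 B (tens x (\sum_j (b j)%:~R *: row j B))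
         (tens y (\sum_j (c j)%:~R *: row j B)) =
  (4 * k * cocycle_form b c)%:~R.
Proof.
move=> xZ yZ xy.
pose X i := Num.floor (2 * x 0 i); pose Y i := Num.floor (2 * y 0 i).
have XE i : (X i)%:~R = 2 * x 0 i by rewrite floorK.
have YE i : (Y i)%:~R = 2 * y 0 i by rewrite floorK.
have coordE (z : 'rV[rat]_n) (Z : 'I_n -> int) (d : 'I_8 -> int) i :
    (Z i)%:~R = 2 * z 0 i ->
    half_coord B (row i (tens z (\sum_j (d j)%:~R *: row j B))) =1
    fun j => Z i * d j.
  move=> ZE j; apply: half_coordE; rewrite ZE /tens row_mul.
  rewrite -scalerA; congr (_ *: _).
  have -> : row i z^T = (z 0 i)%:M by apply/rowP=> l; rewrite !mxE !ord1.
  by rewrite mul_scalar_mx.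
have -> : 4 * k = \sum_i X i * Y i.
  apply/eqP; rewrite -(eqr_int rat) intrM -xy dot_rV mulr_sumr rmorph_sum.
  by apply/eqP; apply: eq_bigr => i _ /=; rewrite intrM XE YE; ring.
rewrite /eps0 mulr_suml rmorph_sum; apply: eq_bigr => i _.
rewrite /eps0_row /cocycle_form mulr_sumr rmorph_sum; apply: eq_bigr => j _.
rewrite mulr_sumr rmorph_sum; apply: eq_bigr => l _.
by rewrite (coordE x X b i) ?(coordE y Y c i) //; congr (_%:~R); ring.
Qed.

(** The two off-diagonal halves add up to the Gram matrix, and the diagonal
    entry 1 is half of the norm of a root. *)
Lemma eps0_basis_sym i j :
  (eps0_basis B i j + eps0_basis B j i)%:~R = dot (row i B) (row j B) :> rat.
Proof.
have BE l : latE8 (row l B) by case: HB => /(_ l)[].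
have hb l m : Num.floor (4 * dot (half_basis B l) (half_basis B m)) =
              Num.floor (dot (row l B) (row m B)).
  by rewrite /half_basis dotZl dotZr; congr Num.floor; field.
have fl l m : (Num.floor (dot (row l B) (row m B)))%:~R = dot (row l B) (row m B).
  by rewrite floorK // latE8_dot_int.
rewrite /eps0_basis; case: (ltngtP i j) => [ij|ij|/val_inj ->].
- by rewrite -val_eqE (ltn_eqF ij) add0r hb fl dotC.
- by rewrite -val_eqE (ltn_eqF ij) addr0 hb fl.
- by rewrite eqxx; case: HB => /(_ j)[_ ->].
Qed.

Lemma cocycle_form_norm (b : 'I_8 -> int) :
  let v := \sum_j (b j)%:~R *: row j B in
  dot v v = 2 * (cocycle_form b b)%:~R.
Proof.
move=> v.
have -> : dot v v = \sum_i \sum_j (b i)%:~R * (b j)%:~R * dot (row i B) (row j B).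
  rewrite /v /dot mulmx_suml linear_sum; apply: eq_bigr => i _.
  rewrite linear_sum mulmx_sumr linear_sum; apply: eq_bigr => j _.
  by rewrite /= -[LHS]/(dot (_ *: _) (_ *: _)) dotZl dotZr mulrA.
have -> : 2 * (cocycle_form b b)%:~R =
  (cocycle_form b b + \sum_j \sum_i b i * b j * eps0_basis B i j)%:~R :> rat.
  rewrite -[X in _ = (_ + X)%:~R]exchange_big /= rmorphD /=; ring.
rewrite /cocycle_form -big_split rmorph_sum; apply: eq_bigr => i _ /=.
rewrite -big_split rmorph_sum; apply: eq_bigr => j _ /=.
rewrite -eps0_basis_sym -!intrM; congr (_%:~R); ring.
Qed.

(** The exponent is a multiple of [4 * dot x x = 8]. *)
Lemma eps_tens_same n (x : 'rV[rat]_n) (u v : 'rV[rat]_8) :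
  (forall i, 2 * x 0 i \is a Num.int) -> dot x x = 2 -> latE8 u -> latE8 v ->
  eps R B (tens x u) (tens x v) = 1.
Proof.
move=> xZ x2 /latE8_coord[b ->] /latE8_coord[c ->].
rewrite /eps (@eps0_tens _ _ _ 2) //.
have -> : (4 * 2 * cocycle_form b c)%:~R = 0 :> 'Z_8.
  by rewrite intrM (_ : (4 * 2)%:~R = 0 :> 'Z_8) ?mul0r //; apply/val_inj.
by rewrite mulr0 mul0r /expi cos0 sin0.
Qed.

(** The exponent is [4 * dot x y] times [dot u u / 2], that is -4 modulo 8. *)
Lemma eps_tens_opp n (x y : 'rV[rat]_n) (u : 'rV[rat]_8) :
  (forall i, 2 * x 0 i \is a Num.int) -> (forall i, 2 * y 0 i \is a Num.int) ->
  dot x y = -1 -> latE8 u -> dot u u = 2 ->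
  eps R B (tens x u) (tens y u) = -1.
Proof.
move=> xZ yZ xy /latE8_coord[b ->] u2.
rewrite /eps (@eps0_tens _ _ _ (-1)) ?rmorphN1 //.
have -> : cocycle_form b b = 1.
  apply/eqP; rewrite -(eqr_int rat); apply/eqP.
  by move: (cocycle_form_norm b); rewrite /= u2; lra.
have -> : (4 * -1 * 1)%:~R = 4%:R :> 'Z_8 by apply/val_inj.
have -> : ((4%:R : 'Z_8) : nat) = 4%N by [].
have -> : 2 * pi * 4%:R / 8 = pi :> R by field.
by rewrite /expi cospi sinpi; apply/eqP; rewrite eq_complex /= oppr0 !eqxx.
Qed.

End Cocycle.

(** * Products of the Ising vectors, axiomatically *)

(** The product rule of the Ising vectors is derived from the product formulas
    alone, in an arbitrary vector space: [quad h g] stands for h(-1) g(-1) 1,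
    [desc h] for h(-2) 1, [ex a] for e^a, [mul] for the product u_1 v, [ep] for
    the cocycle, and [tame] for a subspace on which [mul u] is linear. *)
Module AbstractGriess.

(** With [a], [b] and [c] standing for multiples of q(x,x), q(y,y) and q(x,y),
    this is the cancellation in e(x) + e(y) - e(x + y) that leaves only the
    mixed terms. *)
Lemma cancel_outer (V : zmodType) (a b c d e g : V) :
  a + d + (b + e) - (a + c + (c + b) + g) = d + e - (c + c) - g.
Proof.
rewrite [a + d + _]addrACA [c + b]addrC [a + c + _]addrACA.
rewrite -[a + b + _ + g]addrA opprD [LHS]addrACA subrr add0r opprD.
by rewrite addrA.
Qed.

Section GriessAlgebra.

Variables (F : numFieldType) (V : lmodType F) (n : nat).
Local Notation M := 'M[F]_(n, 8).
Local Notation Phi := E8_roots.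
Variables (quad : M -> M -> V) (desc : M -> V) (ex : 'M[rat]_(n, 8) -> V).
Variables (mul : V -> V -> V) (tame : V -> Prop).
Variable (ep : 'M[rat]_(n, 8) -> 'M[rat]_(n, 8) -> F).
Local Notation cx a := (map_mx (@ratr F) a : M).

Hypothesis quad_lin : forall c h h' g,
  quad (c *: h + h') g = c *: quad h g + quad h' g.
Hypothesis quadC : forall h g, quad h g = quad g h.
Hypothesis descN : forall h, desc (- h) = - desc h.
Hypothesis tame_lin : forall c v w, tame v -> tame w -> tame (c *: v + w).
Hypothesis tame_quad : forall h g, tame (quad h g).
Hypothesis tame_ex : forall a, tame (ex a).
Hypothesis mul_linl : forall c u w v, mul (c *: u + w) v = c *: mul u v + mul w v.
Definition rlinear u := forall c v w, tame v -> tame w ->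
  mul u (c *: v + w) = c *: mul u v + mul u w.
Hypothesis mul_quad_rlinear : forall h g, rlinear (quad h g).
Hypothesis mul_ex_rlinear : forall a, rlinear (ex a).
Hypothesis mul_quad_quad : forall h g h' g', mul (quad h g) (quad h' g') =
  dot g h' *: quad h g' + dot g g' *: quad h h' +
  (dot h h' *: quad g g' + dot h g' *: quad g h').
Hypothesis mul_quad_ex : forall h g a,
  mul (quad h g) (ex a) = (dot (cx a) h * dot (cx a) g) *: ex a.
Hypothesis mul_ex_quad : forall h g a,
  mul (ex a) (quad h g) = (dot (cx a) h * dot (cx a) g) *: ex a.
Hypothesis mul_ex_ex0 : forall a b, - 2 < dot a b -> mul (ex a) (ex b) = 0.
Hypothesis mul_ex_ex2 : forall a b, dot a b = - 2 ->
  mul (ex a) (ex b) = ep a b *: ex (a + b).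
Hypothesis mul_ex_exN : forall a, dot a a = 4 ->
  mul (ex a) (ex (- a)) = (ep a (- a) / 2) *: (desc (cx a) + quad (cx a) (cx a)).

(** For a root x these eight orthogonal vectors of norm 2 span C (x) M_x. *)
Definition unit_tens (x : 'rV[rat]_n) (j : 'I_8) : M := cx (tens x (delta_mx 0 j)).
(** For a root x, [pair_sum x x] is 4 omega_{M_x}; the polarisation is needed
    to expand it at a sum of two roots. *)
Definition pair_sum x y : V := \sum_j quad (unit_tens x j) (unit_tens y j).
Definition exp_sum x : V := \sum_(b <- Phi) ex (tens x b).

Lemma mul0l v : mul 0 v = 0.
Proof.
have := mul_linl 1 0 0 v; rewrite scaler0 addr0 scale1r => /eqP.
by rewrite -subr_eq subrr => /eqP <-.
Qed.

Lemma mulDl u w v : mul (u + w) v = mul u v + mul w v.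
Proof. by rewrite -[u in LHS]scale1r mul_linl scale1r. Qed.

Lemma mulZl c u v : mul (c *: u) v = c *: mul u v.
Proof. by rewrite -[_ *: u]addr0 mul_linl mul0l addr0. Qed.

Lemma tame0 : tame 0.
Proof. by have := tame_lin (-1) (tame_ex 0) (tame_ex 0); rewrite scaleN1r addNr. Qed.

Lemma tameD v w : tame v -> tame w -> tame (v + w).
Proof. by move=> tv tw; rewrite -[v]scale1r; exact: tame_lin. Qed.

Lemma tameZ c v : tame v -> tame (c *: v).
Proof. by move=> tv; rewrite -[_ *: v]addr0; apply: tame_lin => //; exact: tame0. Qed.

Lemma tame_sum (I : eqType) (r : seq I) (f : I -> V) :
  (forall i, tame (f i)) -> tame (\sum_(i <- r) f i).
Proof. by move=> tf; elim/big_ind: _ => //; [exact: tame0|exact: tameD]. Qed.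

Lemma rlinear0 u : rlinear u -> mul u 0 = 0.
Proof.
move=> lu; have := lu 1 0 0 tame0 tame0; rewrite scaler0 addr0 scale1r => /eqP.
by rewrite -subr_eq subrr => /eqP <-.
Qed.

Lemma rlinearD u v w : rlinear u -> tame v -> tame w ->
  mul u (v + w) = mul u v + mul u w.
Proof. by move=> lu tv tw; rewrite -[v in LHS]scale1r lu // scale1r. Qed.

Lemma rlinearZ u c v : rlinear u -> tame v -> mul u (c *: v) = c *: mul u v.
Proof. by move=> lu tv; rewrite -[_ *: v]addr0 lu ?rlinear0 ?addr0 //; exact: tame0. Qed.

Lemma rlinear_comb c u w : rlinear u -> rlinear w -> rlinear (c *: u + w).
Proof.
move=> lu lw d v t tv tt; rewrite !mul_linl lu // lw // !scalerDr !scalerA.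
by rewrite [c * d]mulrC addrACA.
Qed.

Lemma rlinear_zero : rlinear 0.
Proof. by move=> c v w _ _; rewrite !mul0l scaler0 addr0. Qed.

Lemma rlinear_sum (I : eqType) (r : seq I) (f : I -> V) :
  (forall i, rlinear (f i)) -> rlinear (\sum_(i <- r) f i).
Proof.
move=> lf; elim/big_ind: _ => //; first exact: rlinear_zero.
by move=> x y lx ly; rewrite -[x]scale1r; exact: rlinear_comb.
Qed.

(** Left linearity is available everywhere, right linearity only on tame
    vectors. *)
Lemma mul_sum (I J : eqType) (r : seq I) (s : seq J) (f : I -> V) (g : J -> V) :
  (forall i, rlinear (f i)) -> (forall j, tame (g j)) ->
  mul (\sum_(i <- r) f i) (\sum_(j <- s) g j) =
  \sum_(i <- r) \sum_(j <- s) mul (f i) (g j).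
Proof.
move=> lf tg; elim: r => [|i r IHr]; first by rewrite !big_nil mul0l.
rewrite !big_cons mulDl IHr; congr (_ + _).
elim: s {IHr} => [|j s IHs]; first by rewrite !big_nil rlinear0.
by rewrite !big_cons rlinearD ?IHs //; exact: tame_sum.
Qed.

Lemma quadD h h' g : quad (h + h') g = quad h g + quad h' g.
Proof. by rewrite -[h in LHS]scale1r quad_lin scale1r. Qed.

Lemma quad0 g : quad 0 g = 0.
Proof.
have := quad_lin 1 0 0 g; rewrite scaler0 addr0 scale1r => /eqP.
by rewrite -subr_eq subrr => /eqP <-.
Qed.

Lemma quadZ c h g : quad (c *: h) g = c *: quad h g.
Proof. by rewrite -[_ *: h]addr0 quad_lin quad0 addr0. Qed.

Lemma quad_suml (I : Type) (r : seq I) (f : I -> M) g :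
  quad (\sum_(i <- r) f i) g = \sum_(i <- r) quad (f i) g.
Proof.
elim: r => [|i r IHr]; first by rewrite !big_nil quad0.
by rewrite !big_cons quadD IHr.
Qed.

Lemma dot_unit_tens x y i j :
  dot (unit_tens x i) (unit_tens y j) = ratr (dot x y) * (i == j)%:R.
Proof.
by rewrite dot_map dot_tens dot_delta mxE eqxx rmorphM /= eq_sym ratr_nat.
Qed.

Lemma dot_tens_unit x y b j :
  dot (cx (tens y b)) (unit_tens x j) = ratr (dot y x * b 0 j).
Proof. by rewrite dot_map dot_tens dot_delta. Qed.

(** The vectors [unit_tens x i] and [unit_tens y j] are orthogonal for
    [i != j], and for [i = j] the four contractions agree. *)
Lemma mul_pair_sum_pair_sum x y : mul (pair_sum x x) (pair_sum y y) =
  (4 * ratr (dot x y)) *: pair_sum x y.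
Proof.
rewrite /pair_sum mul_sum;
  [|by move=> i; exact: mul_quad_rlinear|by move=> i; exact: tame_quad].
rewrite scaler_sumr; apply: eq_bigr => i _.
rewrite (bigD1 i) //= big1 ?addr0 => [|j /negPf ji].
  rewrite mul_quad_quad !dot_unit_tens eqxx mulr1 -!scalerDl.
  by congr (_ *: _); ring.
by rewrite mul_quad_quad !dot_unit_tens eq_sym ji mulr0 !scale0r !addr0.
Qed.

(** Parseval for the basis [delta_mx 0 j] in the second tensor factor. *)
Lemma sum_dot_unit x y b : \sum_j dot (cx (tens y b)) (unit_tens x j) ^+ 2 =
  ratr (dot x y ^+ 2 * dot b b).
Proof.
rewrite (dot_rV b) mulr_sumr rmorph_sum; apply: eq_bigr => j _ /=.
by rewrite dot_tens_unit -rmorphXn /= (dotC y x) exprMn [b 0 j ^+ 2]expr2.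
Qed.

Lemma mul_pair_sum_exp_sum x y : mul (pair_sum x x) (exp_sum y) =
  (2 * ratr (dot x y ^+ 2)) *: exp_sum y.
Proof.
rewrite /pair_sum /exp_sum mul_sum;
  [|by move=> i; exact: mul_quad_rlinear|by move=> i; exact: tame_ex].
rewrite exchange_big scaler_sumr big_seq [RHS]big_seq; apply: eq_bigr => b bP.
under eq_bigr => j _ do rewrite mul_quad_ex -expr2.
rewrite -scaler_suml sum_dot_unit Phi_norm // rmorphM /= ratr_nat.
by rewrite mulrC.
Qed.

Lemma mul_exp_sum_pair_sum x y : mul (exp_sum x) (pair_sum y y) =
  (2 * ratr (dot x y ^+ 2)) *: exp_sum x.
Proof.
rewrite /pair_sum /exp_sum mul_sum;
  [|by move=> i; exact: mul_ex_rlinear|by move=> i; exact: tame_quad].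
rewrite scaler_sumr big_seq [RHS]big_seq; apply: eq_bigr => b bP.
under eq_bigr => j _ do rewrite mul_ex_quad -expr2.
rewrite -scaler_suml sum_dot_unit Phi_norm // rmorphM /= ratr_nat.
by rewrite mulrC (dotC y).
Qed.

Lemma mul_exp_sum_exp_sum x y : mul (exp_sum x) (exp_sum y) =
  \sum_(b <- Phi) \sum_(c <- Phi) mul (ex (tens x b)) (ex (tens y c)).
Proof.
by rewrite /exp_sum mul_sum // => i; exact: mul_ex_rlinear.
Qed.

(** All exponents are orthogonal, so no product has a pole. *)
Lemma mul_exp_sum_exp_sum_orth x y :
  dot x y = 0 -> mul (exp_sum x) (exp_sum y) = 0.
Proof.
move=> xy; rewrite mul_exp_sum_exp_sum big1 // => b _; rewrite big1 // => c _.
by apply: mul_ex_ex0; rewrite dot_tens xy mul0r; lra.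
Qed.

(** Since [tens x b] and [tens y c] have inner product [- dot b c], a pole of
    order 2 requires [dot b c = 2], that is [b = c]. *)
Lemma mul_exp_sum_exp_sum_adj x y : dot x y = -1 ->
  (forall u, latE8 u -> dot u u = 2 -> ep (tens x u) (tens y u) = -1) ->
  mul (exp_sum x) (exp_sum y) = - exp_sum (x + y).
Proof.
move=> xy epN; rewrite mul_exp_sum_exp_sum /exp_sum -sumrN big_seq [RHS]big_seq.
apply: eq_bigr => b bP.
rewrite (bigD1_seq b) ?uniq_E8_roots //=.
rewrite big_seq_cond big1 ?addr0 => [|c /andP[cP cb]].
  rewrite mul_ex_ex2; last by rewrite dot_tens xy Phi_norm // mulN1r.
  by rewrite epN ?Phi_norm //; [rewrite scaleN1r tensDl|exact: Phi_lat].
apply: mul_ex_ex0; rewrite dot_tens xy mulN1r ltrN2.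
have := Phi_dot bP cP; rewrite !inE.
case/or4P => [/eqP->|/eqP->|/eqP->|/orP[/eqP->|/eqP bc]]; do ?lra.
by rewrite (norm2_eq _ _ bc) ?Phi_norm ?eqxx in cb.
Qed.

Lemma tens_expand x b : cx (tens x b) = \sum_j ratr (b 0 j) *: unit_tens x j.
Proof.
rewrite [b in LHS]row_sum_delta /tens mulmx_sumr raddf_sum /=.
by apply: eq_bigr => j _; rewrite -scalemxAr map_mxZ.
Qed.

(** Expanding [tens x b] in the vectors [unit_tens x j] turns the sum into the
    second moment of the root system. *)
Lemma sum_quad_Phi x :
  \sum_(b <- Phi) quad (cx (tens x b)) (cx (tens x b)) = 60 *: pair_sum x x.
Proof.
transitivity (\sum_i \sum_j
    (ratr (\sum_(b <- Phi) b 0 i * b 0 j) : F) *: quad (unit_tens x i) (unit_tens x j)).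
  transitivity (\sum_(b <- Phi) \sum_i \sum_j
    (ratr (b 0 i * b 0 j) : F) *: quad (unit_tens x i) (unit_tens x j)).
    apply: eq_bigr => b _; rewrite [in X in quad X]tens_expand quad_suml.
    apply: eq_bigr => i _; rewrite quadZ quadC tens_expand quad_suml scaler_sumr.
    by apply: eq_bigr => j _; rewrite quadZ scalerA quadC rmorphM.
  rewrite exchange_big; apply: eq_bigr => i _; rewrite exchange_big.
  by apply: eq_bigr => j _; rewrite rmorph_sum scaler_suml.
rewrite /pair_sum scaler_sumr; apply: eq_bigr => i _.
rewrite (bigD1 i) //= [X in _ + X]big1 ?addr0 => [|j ji]; rewrite E8_roots_moment.
  by rewrite eqxx ratr_nat.
by rewrite eq_sym (negPf ji) rmorph0 scale0r.
Qed.

(** The roots come in opposite pairs. *)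
Lemma sum_desc_Phi x : \sum_(b <- Phi) desc (cx (tens x b)) = 0.
Proof.
set S := \sum_(b <- _) _.
have SN : S = - S.
  rewrite {1}/S -big_Phi_opp -sumrN; apply: eq_bigr => b _.
  by rewrite tensNr map_mxN descN.
have : (2 : F) *: S = 0 by rewrite scaler_nat mulr2n {1}SN addNr.
by move/eqP; rewrite scaler_eq0 pnatr_eq0 => /eqP.
Qed.

(** The inner product is [2 * dot b c].  The pairs with [dot b c = -1] give each
    exponential 56 times; for [c = - b] the product is the weight 2 part of
    exp(sum_m a(-m) z^m / m), whose linear terms cancel in the sum while the
    quadratic ones add up to half of [60 *: pair_sum x x]. *)
Lemma mul_exp_sum_exp_sum_same x : dot x x = 2 ->
  (forall u v, latE8 u -> latE8 v -> ep (tens x u) (tens x v) = 1) ->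
  mul (exp_sum x) (exp_sum x) = 56 *: exp_sum x + 30 *: pair_sum x x.
Proof.
move=> xx ep1; rewrite mul_exp_sum_exp_sum.
transitivity (\sum_(b <- Phi)
   (\sum_(c <- Phi | dot b c == -1) ex (tens x (b + c)) +
   2^-1 *: (desc (cx (tens x b)) + quad (cx (tens x b)) (cx (tens x b))))).
  rewrite big_seq [RHS]big_seq; apply: eq_bigr => b bP.
  (* The term c = - b, a pole of order 4, is set apart. *)
  rewrite (bigD1_seq (- b)) ?uniq_E8_roots ?Phi_opp //= addrC; congr (_ + _).
    rewrite big_mkcond [RHS]big_mkcond big_seq [RHS]big_seq; apply: eq_bigr => c cP.
    have [->|cb] /= := eqVneq c (- b).
      by rewrite dotNr Phi_norm.
    have := Phi_dot bP cP; rewrite !inE => /orP[/eqP bc|bc].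
      by move/eqP: cb; case; apply: norm2_opp => //; exact: Phi_norm.
    have [bc1|bc1] := eqVneq (dot b c) (-1).
      rewrite mul_ex_ex2; last by rewrite dot_tens xx bc1 mulrN1.
      by rewrite ep1 ?scale1r ?tensDr //; exact: Phi_lat.
    apply: mul_ex_ex0; rewrite dot_tens xx.
    by move: bc; rewrite (negPf bc1) /= => /or3P[]/eqP->; lra.
  rewrite tensNr mul_ex_exN; last by rewrite dot_tens xx Phi_norm //; lra.
  by rewrite -tensNr ep1 ?div1r //; [exact: Phi_lat|apply: latE8N; exact: Phi_lat].
rewrite big_split /= (big_Phi_add (fun b => ex (tens x b))); congr (_ + _).
rewrite -scaler_sumr big_split /= sum_desc_Phi add0r sum_quad_Phi scalerA.
by congr (_ *: _); field.
Qed.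

(** The Ising vector e(x), by 1/64 = (1/16) (1/4). *)
Definition ising_elt x : V := 64^-1 *: pair_sum x x + 32^-1 *: exp_sum x.

Lemma tame_pair_sum x y : tame (pair_sum x y).
Proof. by apply: tame_sum => i; exact: tame_quad. Qed.

Lemma tame_exp_sum x : tame (exp_sum x).
Proof. by apply: tame_sum => i; exact: tame_ex. Qed.

Lemma tame_ising_elt x : tame (ising_elt x).
Proof. by apply/tame_lin/tameZ/tame_exp_sum/tame_pair_sum. Qed.

Lemma rlinear_pair_sum x y : rlinear (pair_sum x y).
Proof. by apply: rlinear_sum => i; exact: mul_quad_rlinear. Qed.

Lemma rlinear_exp_sum x : rlinear (exp_sum x).
Proof. by apply: rlinear_sum => i; exact: mul_ex_rlinear. Qed.

Lemma rlinear_ising_elt x : rlinear (ising_elt x).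
Proof.
apply: rlinear_comb; first exact: rlinear_pair_sum.
rewrite -[_ *: _]addr0; apply: rlinear_comb; [exact: rlinear_exp_sum|exact: rlinear_zero].
Qed.

Lemma mul_ising_eltE x y : mul (ising_elt x) (ising_elt y) =
  64^-1 *: (64^-1 *: mul (pair_sum x x) (pair_sum y y) +
            32^-1 *: mul (pair_sum x x) (exp_sum y)) +
  32^-1 *: (64^-1 *: mul (exp_sum x) (pair_sum y y) +
            32^-1 *: mul (exp_sum x) (exp_sum y)).
Proof.
rewrite /ising_elt mul_linl mulZl.
have tE := tameZ 32^-1 (tame_exp_sum y); have tG := tame_pair_sum y y.
by rewrite (rlinear_pair_sum _ _ _ tG tE) (rlinear_exp_sum _ _ tG tE) !rlinearZ //;
  [exact: rlinear_exp_sum|exact: tame_exp_sum|exact: rlinear_pair_sum|exact: tame_exp_sum].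
Qed.

Lemma mul_ising_elt_orth x y :
  dot x y = 0 -> mul (ising_elt x) (ising_elt y) = 0.
Proof.
move=> xy; rewrite mul_ising_eltE mul_pair_sum_pair_sum mul_pair_sum_exp_sum.
rewrite mul_exp_sum_pair_sum mul_exp_sum_exp_sum_orth // xy.
by rewrite expr0n /= !rmorph0 !mulr0 !scale0r !(scaler0, addr0).
Qed.

Lemma pair_sumDl x y z : pair_sum (x + y) z = pair_sum x z + pair_sum y z.
Proof.
rewrite /pair_sum -big_split; apply: eq_bigr => j _ /=.
by rewrite {1}/unit_tens tensDl map_mxD quadD.
Qed.

Lemma pair_sumC x y : pair_sum x y = pair_sum y x.
Proof. by apply: eq_bigr => j _; rewrite quadC. Qed.

Lemma unit_tensN x j : unit_tens (- x) j = - unit_tens x j.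
Proof. by rewrite /unit_tens tensNl map_mxN. Qed.

Lemma quadNN h : quad (- h) (- h) = quad h h.
Proof.
by rewrite -scaleN1r quadZ (quadC h) quadZ scalerA mulrNN mulr1 scale1r.
Qed.

Lemma ising_eltN x : ising_elt (- x) = ising_elt x.
Proof.
rewrite /ising_elt; congr (_ *: _ + _ *: _).
  by apply: eq_bigr => j _; rewrite unit_tensN quadNN.
rewrite /exp_sum -big_Phi_opp; apply: eq_bigr => b _.
by rewrite tensNl tensNr opprK.
Qed.

(** On the right q(x,x) and q(y,y) cancel against the expansion of
    q(x + y, x + y), leaving the mixed term that the left-hand side produces. *)
Lemma mul_ising_elt_adj x y : dot x y = -1 ->
  (forall u, latE8 u -> dot u u = 2 -> ep (tens x u) (tens y u) = -1) ->
  mul (ising_elt x) (ising_elt y) =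
  32^-1 *: (ising_elt x + ising_elt y - ising_elt (x + y)).
Proof.
move=> xy epN.
rewrite mul_ising_eltE mul_pair_sum_pair_sum mul_pair_sum_exp_sum.
rewrite mul_exp_sum_pair_sum mul_exp_sum_exp_sum_adj // xy.
have pair_sumD2 : pair_sum (x + y) (x + y) =
    pair_sum x x + pair_sum x y + (pair_sum x y + pair_sum y y).
  by rewrite pair_sumDl !(pair_sumC _ (x + y)) !pair_sumDl (pair_sumC y x).
rewrite sqrrN expr1n rmorphN1 rmorph1 /ising_elt pair_sumD2.
move: (pair_sum x x) (pair_sum y y) (pair_sum x y) => a b c.
move: (exp_sum x) (exp_sum y) (exp_sum (x + y)) => d e f.
rewrite ![64^-1 *: (_ + _)]scalerDr cancel_outer.
rewrite !(scalerDr, scalerN, scalerA) -!scaleNr.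
rewrite -scalerDl -scaleNr [LHS]addrA; congr (_ + _).
rewrite [LHS]addrC [X in _ + X = _]addrC [LHS]addrA.
by congr (_ *: _ + _ *: _ + _ *: _); field.
Qed.

Lemma mul_ising_elt_same x : dot x x = 2 ->
  (forall u v, latE8 u -> latE8 v -> ep (tens x u) (tens x v) = 1) ->
  mul (ising_elt x) (ising_elt x) = 2 *: ising_elt x.
Proof.
move=> xx ep1.
rewrite mul_ising_eltE mul_pair_sum_pair_sum mul_pair_sum_exp_sum.
rewrite mul_exp_sum_pair_sum mul_exp_sum_exp_sum_same // xx.
rewrite rmorphXn /= ratr_nat /ising_elt.
move: (pair_sum x x) (exp_sum x) => a b.
have collect p q r s t : p *: a + q *: b + (r *: b + (s *: b + t *: a)) =
    (p + t) *: a + (q + r + s) *: b.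
  by rewrite !scalerDl [RHS]addrAC !addrA.
rewrite !(scalerDr, scalerA) collect.
by congr (_ *: _ + _ *: _); field.
Qed.

End GriessAlgebra.

End AbstractGriess.

(** * The oscillators of the Fock space *)

(** [ket] and the oscillator modes, sealed: two Fock vectors are then compared by
    their labels and not by unfolding finitely supported functions.  In [cre]
    and [ann] the index [k] stands for the mode numbers -k-1 and k+1, and [mom]
    is the mode 0. *)
HB.lock Definition sket (R : realType) (n : nat) (s : {mset osc n}%mset)
  (a : 'M[rat]_(n, 8)) : fock R n := ket R s a.
HB.lock Definition cre (R : realType) (n : nat) (p : 'I_n * 'I_8) (k : nat) :
  fock R n -> fock R n := heis_ij p (Negz k).
HB.lock Definition ann (R : realType) (n : nat) (p : 'I_n * 'I_8) (k : nat) :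
  fock R n -> fock R n := heis_ij p (Posz k.+1).
HB.lock Definition mom (R : realType) (n : nat) (p : 'I_n * 'I_8) :
  fock R n -> fock R n := heis_ij p (Posz 0).
Arguments sket R {n} s a.

Lemma msetB1C (K : choiceType) (s : {mset K}%mset) x y :
  (s `\ x `\ y = s `\ y `\ x)%mset.
Proof. by apply/msetP=> z; rewrite !msetB1E subnAC. Qed.

Lemma msetB1_neq (K : choiceType) (s : {mset K}%mset) x y : x != y ->
  (s `\ y)%mset x = s x.
Proof. by move=> xy; rewrite msetB1E (negPf xy) subn0. Qed.

Lemma msetD1B (K : choiceType) (s : {mset K}%mset) x y : x != y ->
  ((y +` s) `\ x = y +` (s `\ x))%mset.
Proof.
move=> xy; apply/msetP => z; rewrite msetB1E !mset1DE msetB1E.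
have [->|//] := eqVneq z y.
by rewrite eq_sym (negPf xy) !subn0.
Qed.

Section Oscillators.

Variables (R : realType) (n : nat).
Local Notation C := R[i].
Local Notation fock := (fock R n).

Lemma fock_linEw (f : fock_key n -> fock) (d : {fset fock_key n}) (v : fock) :
  (msupp v `<=` d)%fset -> fock_lin f v = \sum_(x <- d) v@_x *: f x.
Proof.
move=> vd; rewrite /fock_lin (big_fset_incl _ vd) //= => x _ xv.
by rewrite mcoeff_outdom ?scale0r.
Qed.

Lemma fock_lin_is_linear (f : fock_key n -> fock) : linear (fock_lin f).
Proof.
move=> c u v.
pose d := (msupp u `|` msupp v `|` msupp (c *: u + v))%fset.
rewrite !(@fock_linEw f d); last first.
- by apply/fsubsetP=> x xu; rewrite !inE xu orbT.
- by apply/fsubsetP=> x xu; rewrite !inE xu.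
- by apply/fsubsetP=> x xu; rewrite !inE xu orbT.
rewrite scaler_sumr -big_split /=; apply: eq_bigr => x _.
by rewrite mcoeffD mcoeffZ scalerDl scalerA.
Qed.

HB.instance Definition _ (f : fock_key n -> fock) :=
  GRing.isLinear.Build C fock fock _ (fock_lin f) (fock_lin_is_linear f).

Lemma fock_lin_ket (f : fock_key n -> fock) s a :
  fock_lin f (ket R s a) = f (s, a).
Proof.
rewrite /fock_lin /ket msuppU oner_eq0 big_seq_fset1.
by rewrite mcoeffUU scale1r.
Qed.

Lemma fock_lin_sket (f : fock_key n -> fock) s a :
  fock_lin f (sket R s a) = f (s, a).
Proof. by rewrite unlock fock_lin_ket. Qed.

Lemma mcoeff_sket (s : {mset osc n}%mset) a k : (sket R s a)@_k = ((s, a) == k)%:R.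
Proof. rewrite unlock; exact: mcoeffU. Qed.

Lemma mcoeff_lin (c : C) (u v : fock) k : (c *: u + v)@_k = c * u@_k + v@_k.
Proof. by rewrite mcoeffD mcoeffZ. Qed.

Lemma mcoeff_scale (c : C) (v : fock) k : (c *: v)@_k = c * v@_k.
Proof. exact: mcoeffZ. Qed.

Lemma fock_expand (v : fock) :
  v = \sum_(x <- msupp v) v@_x *: sket R x.1 x.2.
Proof.
rewrite {1}[v]monalgE; apply: eq_bigr => -[s a] _.
apply/malgP=> k; rewrite mcoeffU mcoeffZ mcoeff_sket.
exact/esym/mulr_natr.
Qed.

(** Operators are compared on monomials, where the oscillator relations are
    statements about multisets. *)
Lemma fock_linear_ext (f g : {linear fock -> fock}) :
  (forall s a, f (sket R s a) = g (sket R s a)) -> f =1 g.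
Proof.
move=> fg v; rewrite [v]fock_expand !linear_sum.
by apply: eq_bigr => x _; rewrite !linearZ /= fg.
Qed.

HB.instance Definition _ (p : 'I_n * 'I_8) (m : int) :=
  GRing.Linear.copy (@heis_ij R n p m) (fock_lin _).

Lemma heis_is_linear (h : 'M[C]_(n, 8)) m : linear (heis h m : fock -> fock).
Proof.
move=> c u v; rewrite /heis scaler_sumr -big_split /=; apply: eq_bigr => p _.
by rewrite linearP scalerDr !scalerA mulrC.
Qed.

HB.instance Definition _ (h : 'M[C]_(n, 8)) (m : int) :=
  GRing.isLinear.Build C fock fock _ (heis h m) (heis_is_linear h m).

Lemma cre_is_linear p k : linear (cre p k : fock -> fock).
Proof. by rewrite unlock; exact: linearP. Qed.
Lemma ann_is_linear p k : linear (ann p k : fock -> fock).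
Proof. by rewrite unlock; exact: linearP. Qed.
Lemma mom_is_linear p : linear (mom p : fock -> fock).
Proof. by rewrite unlock; exact: linearP. Qed.
HB.instance Definition _ p k :=
  GRing.isLinear.Build C fock fock _ (cre p k) (cre_is_linear p k).
HB.instance Definition _ p k :=
  GRing.isLinear.Build C fock fock _ (ann p k) (ann_is_linear p k).
HB.instance Definition _ p :=
  GRing.isLinear.Build C fock fock _ (mom p) (mom_is_linear p).

Lemma creZ p k (c : C) (v : fock) : cre p k (c *: v) = c *: cre p k v.
Proof. exact: linearZZ. Qed.
Lemma annZ p k (c : C) (v : fock) : ann p k (c *: v) = c *: ann p k v.
Proof. exact: linearZZ. Qed.
Lemma momZ p (c : C) (v : fock) : mom p (c *: v) = c *: mom p v.
Proof. exact: linearZZ. Qed.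

Lemma cre_sket p k (s : {mset osc n}%mset) a :
  cre p k (sket R s a) = sket R ((p, k) +` s)%mset a.
Proof. rewrite !unlock; exact: fock_lin_ket. Qed.

Lemma mom_sket p s (a : 'M_(n, 8)) :
  mom p (sket R s a) = ratr (a p.1 p.2) *: sket R s a.
Proof. rewrite !unlock; exact: fock_lin_ket. Qed.

Lemma ann_sket p k s (a : 'M_(n, 8)) :
  ann p k (sket R s a) =
  (k.+1 * s (p, k))%:R *: sket R (s `\ (p, k))%mset a.
Proof. rewrite !unlock; exact: fock_lin_ket. Qed.

(** If [p = q] and [(p, 0)] has multiplicity [m], the two orders of the operators
    give the factors [m + 1] and [m]. *)
Lemma ann_cre p q (v : fock) :
  ann p 0 (cre q 0 v) = cre q 0 (ann p 0 v) + (p == q)%:R *: v.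
Proof.
apply: (@fock_linear_ext
  ((ann p 0 \o cre q 0))
  ((cre q 0 \o ann p 0) \+ (p == q)%:R \*: idfun)) => s a /=.
rewrite cre_sket !ann_sket creZ cre_sket !mul1n mset1DE.
have [->|pq] := eqVneq p q.
  rewrite eqxx msetD1K scale1r -[X in _ + X]scale1r.
  have [s0|s0] := posnP (s (q, 0)).
    by rewrite s0 scale0r add0r addn0.
  by rewrite msetB1K ?in_mset // -scalerDl addrC natrD.
have pq0 : ((p, 0) == (q, 0) :> osc n) = false.
  by rewrite xpair_eqE (negPf pq).
rewrite pq0 scale0r addr0 add0n; congr (_ *: sket R _ a).
by rewrite msetD1B // pq0.
Qed.

Lemma ann_cre_far p q m (v : fock) :
  ann p m.+1 (cre q 0 v) = cre q 0 (ann p m.+1 v).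
Proof.
apply: (@fock_linear_ext (ann p m.+1 \o cre q 0) (cre q 0 \o ann p m.+1)).
move=> s a /=.
rewrite cre_sket !ann_sket creZ cre_sket mset1DE.
have pq0 : ((p, m.+1) == (q, 0) :> osc n) = false.
  by rewrite xpair_eqE andbF.
rewrite pq0 add0n; congr (_ *: sket R _ a).
by rewrite msetD1B // pq0.
Qed.

Lemma mom_cre p q k (v : fock) : mom p (cre q k v) = cre q k (mom p v).
Proof.
apply: (@fock_linear_ext (mom p \o cre q k) (cre q k \o mom p)) => s a /=.
by rewrite cre_sket !mom_sket creZ cre_sket.
Qed.

Lemma mom_mom p q (v : fock) : mom p (mom q v) = mom q (mom p v).
Proof.
apply: (@fock_linear_ext (mom p \o mom q) (mom q \o mom p)) => s a /=.
by rewrite !mom_sket !momZ !mom_sket !scalerA mulrC.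
Qed.

Lemma ann_ann p q k l (v : fock) : ann p k (ann q l v) = ann q l (ann p k v).
Proof.
apply: (@fock_linear_ext (ann p k \o ann q l) (ann q l \o ann p k)) => s a /=.
rewrite !ann_sket !annZ !ann_sket !scalerA -!natrM.
have [[-> ->]//|pq] := eqVneq (p, k) (q, l).
have qp : (q, l) != (p, k) by rewrite eq_sym.
rewrite (msetB1_neq s pq) (msetB1_neq s qp) mulnC; congr (_ *: sket R _ a).
exact: msetB1C.
Qed.

End Oscillators.

Local Opaque Defs.fock ket.

HB.lock Definition hcre (R : realType) (n : nat) (h : 'M[R[i]]_(n, 8)) (k : nat) :
  fock R n -> fock R n := heis h (Negz k).
HB.lock Definition hann (R : realType) (n : nat) (h : 'M[R[i]]_(n, 8)) (k : nat) :
  fock R n -> fock R n := heis h (Posz k.+1).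
HB.lock Definition hmom (R : realType) (n : nat) (h : 'M[R[i]]_(n, 8)) :
  fock R n -> fock R n := heis h (Posz 0).

Section HeisenbergModes.

Variables (R : realType) (n : nat).
Local Notation C := R[i].
Local Notation fock := (fock R n).
Implicit Types (c : C) (v w : fock) (h g : 'M[C]_(n, 8)) (a b : 'M[rat]_(n, 8)).

Local Notation ex a := (sket R mset0 a).

Lemma hcreE h k v : hcre h k v = \sum_p h p.1 p.2 *: cre p k v.
Proof. by rewrite [hcre]unlock [cre]unlock. Qed.
Lemma hannE h k v : hann h k v = \sum_p h p.1 p.2 *: ann p k v.
Proof. by rewrite [hann]unlock [ann]unlock. Qed.
Lemma hmomE h v : hmom h v = \sum_p h p.1 p.2 *: mom p v.
Proof. by rewrite [hmom]unlock [mom]unlock. Qed.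

Lemma hcre_is_linear h k : linear (hcre h k : fock -> fock).
Proof. by rewrite unlock; exact: linearP. Qed.
Lemma hann_is_linear h k : linear (hann h k : fock -> fock).
Proof. by rewrite unlock; exact: linearP. Qed.
Lemma hmom_is_linear h : linear (hmom h : fock -> fock).
Proof. by rewrite unlock; exact: linearP. Qed.
HB.instance Definition _ h k :=
  GRing.isLinear.Build C fock fock _ (hcre h k) (hcre_is_linear h k).
HB.instance Definition _ h k :=
  GRing.isLinear.Build C fock fock _ (hann h k) (hann_is_linear h k).
HB.instance Definition _ h :=
  GRing.isLinear.Build C fock fock _ (hmom h) (hmom_is_linear h).

Lemma hcreZ h k c v : hcre h k (c *: v) = c *: hcre h k v.
Proof. exact: linearZZ. Qed.
Lemma hannZ h k c v : hann h k (c *: v) = c *: hann h k v.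
Proof. exact: linearZZ. Qed.
Lemma hmomZ h c v : hmom h (c *: v) = c *: hmom h v.
Proof. exact: linearZZ. Qed.

Lemma hcreDl h g k v : hcre (h + g) k v = hcre h k v + hcre g k v.
Proof.
by rewrite !hcreE -big_split; apply: eq_bigr => p _; rewrite mxE scalerDl.
Qed.

Lemma hcreZl c h k v : hcre (c *: h) k v = c *: hcre h k v.
Proof.
by rewrite !hcreE scaler_sumr; apply: eq_bigr => p _; rewrite mxE scalerA.
Qed.

Lemma hann_hcre h g v :
  hann h 0 (hcre g 0 v) = hcre g 0 (hann h 0 v) + dot h g *: v.
Proof.
rewrite !hannE hcreE linear_sum /=.
under [X in X = _]eq_bigr => p _.
  rewrite linear_sum /= scaler_sumr.
  under eq_bigr => q _ do rewrite annZ ann_cre scalerDr scalerDr.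
  rewrite big_split /=.
  over.
rewrite big_split /=; congr (_ + _).
  apply: eq_bigr => p _; rewrite hcreZ hcreE scaler_sumr.
  by apply: eq_bigr => q _; rewrite !scalerA.
rewrite dotE scaler_suml; apply: eq_bigr => p _.
rewrite (bigD1 p) //= big1 ?addr0 => [|q /negPf qp].
  by rewrite eqxx scale1r scalerA.
by rewrite eq_sym qp scale0r !scaler0.
Qed.

Lemma hmom_hcre h g k v : hmom h (hcre g k v) = hcre g k (hmom h v).
Proof.
rewrite !hmomE linear_sum /=; apply: eq_bigr => p _; rewrite hcreZ !hcreE.
congr (_ *: _); rewrite linear_sum /=; apply: eq_bigr => q _.
by rewrite momZ mom_cre.
Qed.

Lemma ann_ex p k a : ann p k (ex a) = 0.
Proof. by rewrite ann_sket mset0E muln0 scale0r. Qed.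

Lemma hann_ex h k a : hann h k (ex a) = 0.
Proof. by rewrite hannE big1 // => p _; rewrite ann_ex scaler0. Qed.

Lemma hmom_ex h a : hmom h (ex a) = dot h (cplx R a) *: ex a.
Proof.
rewrite hmomE dotE scaler_suml; apply: eq_bigr => p _.
by rewrite mom_sket scalerA mxE.
Qed.

(** Vectors killed by all modes p(m) with m >= 2.  Only oscillators of degree 1
    occur in the Ising vectors, so their span is tame. *)
Definition tame : set fock := [set v | forall p k, ann p k.+1 v = 0].

(** The product [nprod B u 1 v], for a quadratic state [u], is linear in [v]
    because all [v] of this subspace meet the same finitely many modes. *)
Lemma tame_subspace : is_subspace tame.
Proof.
split=> [p k|c x y tx ty p k]; first by rewrite linear0.
by rewrite linearP /= tx ty scaler0 addr0.
Qed.

Lemma tame_lin c v w : tame v -> tame w -> tame (c *: v + w).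
Proof. exact: tame_subspace.2. Qed.

Lemma tame_scale c v : tame v -> tame (c *: v).
Proof. by move=> tv p k; rewrite annZ tv scaler0. Qed.

Lemma tame_sum (I : Type) (r : seq I) (F : I -> fock) :
  (forall i, tame (F i)) -> tame (\sum_(i <- r) F i).
Proof.
by move=> tF p k; rewrite linear_sum /= big1 // => i _; exact: tF.
Qed.

Lemma tame_ex a : tame (ex a).
Proof. by move=> p k; rewrite ann_ex. Qed.

Lemma tame_cre p v : tame v -> tame (cre p 0 v).
Proof. by move=> tv q k; rewrite ann_cre_far tv linear0. Qed.

Lemma tame_hcre h v : tame v -> tame (hcre h 0 v).
Proof.
move=> tv; rewrite hcreE; apply: tame_sum => p.
exact/tame_scale/tame_cre.
Qed.

Lemma tame_ann p k v : tame v -> tame (ann p k v).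
Proof. by move=> tv q l; rewrite ann_ann tv linear0. Qed.

Lemma tame_hann h k v : tame v -> tame (hann h k v).
Proof.
move=> tv; rewrite hannE; apply: tame_sum => p.
exact/tame_scale/tame_ann.
Qed.

Lemma hann_tame h k v : tame v -> hann h k.+1 v = 0.
Proof. by move=> tv; rewrite hannE big1 // => p _; rewrite tv scaler0. Qed.

(** When only the coefficient of z^1 acts, the r-th power of the series is its
    r-th iterate times z^r. *)
Lemma series_pow_tame (X : nat -> fock -> fock) r k v :
  (forall m, X m 0 = 0) ->
  (forall s m, X m.+2 (iter s (X 1%N) v) = 0) ->
  series_pow X r k v = if k == r then iter r (X 1%N) v else 0.
Proof.
move=> X0 Xv; elim: r k => [|r IHr] k //=.
case: k => [|k].
  by rewrite big_nat big1 // => m; case: m.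
rewrite big_ltn // subSS subn0 IHr eqSS.
rewrite big_nat big1 ?addr0 => [|[|[|m]]//= _].
  by case: eqP => // _; rewrite X0.
by rewrite IHr; case: eqP => // _; rewrite ?X0 ?Xv.
Qed.

Lemma series_exp_tame (X : nat -> fock -> fock) k v :
  (forall m, X m 0 = 0) ->
  (forall s m, X m.+2 (iter s (X 1%N) v) = 0) ->
  series_exp X k v = (k`!)%:R^-1 *: iter k (X 1%N) v.
Proof.
move=> X0 Xv; rewrite /series_exp big_nat_recr //= big_nat big1 ?add0r.
  by rewrite (series_pow_tame _ _ X0 Xv) eqxx.
move=> r /andP[_ rk]; rewrite (series_pow_tame _ _ X0 Xv).
by rewrite gtn_eqF // scaler0.
Qed.

End HeisenbergModes.

(** * The modes of the vertex operators *)

Section VertexModes.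

Variables (R : realType) (n : nat) (B : 'M[rat]_8).
Local Notation C := R[i].
Local Notation fock := (fock R n).
Implicit Types (c : C) (v w : fock) (h g : 'M[C]_(n, 8)) (a b : 'M[rat]_(n, 8)).

Local Notation ex a := (sket R mset0 a).

(** Sums over infinite index sets are reduced to finite ones through this: the
    sums that occur have a support of one or two elements. *)
Lemma fsbig_single (T : choiceType) (S : set T) (F : T -> fock) (x : T) :
  S x -> (forall y, S y -> y != x -> F y = 0) -> \sum_(y \in S) F y = F x.
Proof.
move=> Sx F0; rewrite -(fsbig_set1 +%R x F); apply/esym/fsbig_widen.
  by move=> _ ->.
by move=> y [Sy /eqP yx]; apply: F0.
Qed.

Lemma E_plus_tame a l v : tame v ->
  E_plus a l v = (l`!)%:R^-1 *: iter l (fun w => - hann (cplx R a) 0 w) v.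
Proof.
move=> tv.
have X1 w : - 1%:R^-1 *: heis (cplx R a) 1%:Z w = - hann (cplx R a) 0 w.
  by rewrite invr1 scaleN1r [hann]unlock.
have tX s : tame (iter s (fun w => - hann (cplx R a) 0 w) v).
  elim: s => [//|s IHs] /=; rewrite -scaleN1r.
  exact/tame_scale/tame_hann.
have iX s : iter s (fun w => - 1%:R^-1 *: heis (cplx R a) 1%:Z w) v =
            iter s (fun w => - hann (cplx R a) 0 w) v.
  by apply: eq_iter => w; rewrite X1.
rewrite /E_plus series_exp_tame ?iX // => [m|s m].
  by rewrite linear0 scaler0.
rewrite iX; have := hann_tame (cplx R a) m (tX s).
by rewrite [hann]unlock => ->; rewrite scaler0.
Qed.

Lemma E_minus0 a v : E_minus a 0 v = v.
Proof. by rewrite /E_minus /series_exp big_nat1 invr1 scale1r. Qed.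

Lemma series_pow1 (X : nat -> fock -> fock) k v : (forall m, X m 0 = 0) ->
  series_pow X 1 k.+1 v = X k.+1 v.
Proof.
move=> X0; rewrite [LHS]big_nat_recr //= subnn /=.
rewrite big_nat big1 ?add0r // => m /andP[_ mk].
by rewrite /= subn_eq0 leqNgt mk X0.
Qed.

Lemma sum_nat3 (V : nmodType) (F : nat -> V) :
  \sum_(0 <= r < 3) F r = F 0%N + (F 1%N + F 2%N).
Proof. by rewrite 3?big_ltn // big_geq // addr0. Qed.

Lemma series_pow2 (X : nat -> fock -> fock) v : (forall m, X m 0 = 0) ->
  series_pow X 2 2 v = X 1%N (X 1%N v).
Proof.
move=> X0; have -> : series_pow X 2 2 v =
  \sum_(1 <= m < 3) X m (series_pow X 1 (2 - m) v) by [].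
rewrite big_ltn // big_nat1 subnn (series_pow1 0) //.
have -> : series_pow X 1 0 v = 0 by rewrite [LHS]big_geq.
by rewrite X0 addr0.
Qed.

Lemma series_exp2 (X : nat -> fock -> fock) v : (forall m, X m 0 = 0) ->
  series_exp X 2 v = X 2 v + 2^-1 *: X 1%N (X 1%N v).
Proof.
move=> X0; rewrite /series_exp sum_nat3 series_pow1 // series_pow2 //.
have -> : series_pow X 0 2 v = 0 by [].
by rewrite scaler0 add0r invr1 scale1r.
Qed.

Lemma E_minus2 a v :
  E_minus a 2 v = 2^-1 *: (hcre (cplx R a) 1 v +
                           hcre (cplx R a) 0 (hcre (cplx R a) 0 v)).
Proof.
rewrite /E_minus series_exp2 => [|m]; last by rewrite linear0 scaler0.
by rewrite invr1 !scale1r scalerDr [hcre]unlock.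
Qed.
Lemma series_exp0 (X : nat -> fock -> fock) k v :
  (forall m w, X m w = 0) -> series_exp X k v = if k == 0%N then v else 0.
Proof.
move=> X0; rewrite series_exp_tame //.
by case: k => [|k]; rewrite ?invr1 ?scale1r //= X0 scaler0.
Qed.

Lemma cplx0 : cplx R (0 : 'M_(n, 8)) = 0.
Proof. exact: map_mx0. Qed.

Lemma heis0 m v : heis 0 m v = 0.
Proof. by rewrite /heis big1 // => p _; rewrite mxE scale0r. Qed.

Lemma half_coord0 i : half_coord B 0 i = 0.
Proof. by rewrite /half_coord mul0mx mxE floor0. Qed.

Lemma eps0l b : eps R B 0 b = 1.
Proof.
rewrite /eps /eps0 big1 => [|i _].
  by rewrite mulr0 mul0r /expi cos0 sin0.
rewrite /eps0_row big1 // => j _; rewrite big1 // => k _.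
by rewrite row0 half_coord0 !mul0r.
Qed.

Lemma eps0r a : eps R B a 0 = 1.
Proof.
rewrite /eps /eps0 big1 => [|i _].
  by rewrite mulr0 mul0r /expi cos0 sin0.
rewrite /eps0_row big1 // => j _; rewrite big1 // => k _.
by rewrite row0 half_coord0 mulr0 mul0r.
Qed.

HB.instance Definition _ a N :=
  GRing.Linear.copy (@Y_expo R n B a N) (fock_lin _).

(** Y(e^0, z) is the identity, so only its mode -1 is nonzero. *)
Lemma Y_expo0 N v : Y_expo B 0 N v = if N == - 1 then v else 0.
Proof.
have -> : (if N == - 1 then v else 0) = ((N == - 1)%:R \*: idfun) v :> fock.
  by rewrite /=; case: eqP; rewrite ?scale1r ?scale0r.
apply: (@fock_linear_ext R n (Y_expo B 0 N) ((N == - 1)%:R \*: idfun)) => s b.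
have X0 (c : nat -> C) (f : nat -> int) m (w : fock) :
    c m *: heis (cplx R (0 : 'M_(n, 8))) (f m) w = 0.
  by rewrite cplx0 heis0 scaler0.
rewrite [LHS]fock_lin_sket eps0l scale1r /= add0r dot0l.
pose F (kl : nat * nat) : fock := E_minus 0 kl.1 (E_plus 0 kl.2 (sket R s b)).
have F0 kl : kl != (0, 0)%N -> F kl = 0.
  case: kl => k l kl0; rewrite /F /E_minus /E_plus.
  rewrite (series_exp0 _ _ (X0 (fun m => m%:R^-1) (fun m => - m%:Z))).
  rewrite (series_exp0 _ _ (X0 (fun m => - m%:R^-1) (fun m => m%:Z))) /=.
  by case: k l kl0 => [|k] [|l].
have F00 : F (0, 0)%N = sket R s b.
  rewrite /F /E_minus /E_plus.
  rewrite (series_exp0 _ _ (X0 (fun m => m%:R^-1) (fun m => - m%:Z))).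
  by rewrite (series_exp0 _ _ (X0 (fun m => - m%:R^-1) (fun m => m%:Z))).
rewrite -[ket R s b]/(ket R s b) (_ : ket R s b = sket R s b); last first.
  by rewrite [sket]unlock.
have [->|N1] := eqVneq N (- 1).
  transitivity (F (0, 0)%N); last by rewrite F00 scale1r.
  apply: (@fsbig_single _ _ F) => [|kl _]; last exact: F0.
  by rewrite /= subrr rmorphN rmorph1 opprK subrr.
rewrite scale0r; apply: fsbig1 => kl /= klN; apply: F0.
apply: contra_neq N1 => kl0; apply/eqP.
have /eqP : N%:~R = (- 1)%:~R :> rat; last by rewrite eqr_int.
by move: klN; rewrite kl0 /= rmorphN1; lra.
Qed.

Lemma fsbig_nat2 (F : nat -> fock) : (forall j, F j.+2 = 0) ->
  \sum_(j \in [set: nat]) F j = F 0%N + F 1%N.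
Proof.
move=> F0; rewrite -(fsbig_widen `I_2 setT) //; last first.
  by case=> [|[|j]] [_] //= _; apply: F0.
by rewrite -fsbig_ord big_ord_recl big_ord1.
Qed.

Lemma Y_key_cons q t a N v : Y_key B ((q, 0%N) :: t) a N v =
  \sum_(j \in [set: nat]) heis_ij q (Negz j) (Y_key B t a (N + j%:Z) v) +
  \sum_(j \in [set: nat]) Y_key B t a (N - j%:Z - 1) (heis_ij q (Posz j) v).
Proof.
rewrite [LHS]/=; congr (_ + _); apply: eq_fsbigr => j _.
  by rewrite bin0 scale1r subr0.
by rewrite bin0 expr0 mulr1 scale1r subr0.
Qed.

(** A normally ordered product with the identity field: for each mode [N] a
    single term survives, in the creation part if [N] is negative and in the
    annihilation part otherwise. *)
Lemma Y_key_field q N v : Y_key B [:: (q, 0%N)] 0 N v = heis_ij q N v.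
Proof.
rewrite Y_key_cons.
pose F (j : nat) := heis_ij q (Negz j) (Y_expo B 0 (N + j%:Z) v).
pose G (j : nat) := Y_expo B 0 (N - j%:Z - 1) (heis_ij q (Posz j) v).
rewrite -[LHS]/(\sum_(j \in [set: nat]) F j + \sum_(j \in [set: nat]) G j).
have F0 j : N + j%:Z <> - 1 -> F j = 0.
  by move=> /eqP/negPf N1; rewrite /F Y_expo0 N1 linear0.
have G0 j : N - j%:Z <> 0 -> G j = 0.
  move=> N1; rewrite /G Y_expo0 ifF //; apply/negP => /eqP E; apply: N1; lia.
have F1 j : N + j%:Z = - 1 -> F j = heis_ij q (Negz j) v.
  by move=> N1; rewrite /F N1 Y_expo0 eqxx.
have G1 j : N - j%:Z = 0 -> G j = heis_ij q (Posz j) v.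
  by move=> N1; rewrite /G N1 Y_expo0 sub0r eqxx.
clearbody F G; case: N F0 G0 F1 G1 => m F0 G0 F1 G1.
  rewrite (fsbig1 _ (F := F)) ?add0r => [|j _]; last by apply: F0; lia.
  rewrite (@fsbig_single _ _ G m) // => [|j _ /eqP jm].
    by apply: G1; rewrite subrr.
  by apply: G0 => E; apply: jm; lia.
rewrite (fsbig1 _ (F := G)) ?addr0 => [|j _]; last by apply: G0; lia.
rewrite (@fsbig_single _ _ F m) // => [|j _ /eqP jm].
  by apply: F1; lia.
by apply: F0 => E; apply: jm; lia.
Qed.

(** The mode of degree 0 of the normally ordered product :p(z) q(z):, truncated
    to oscillators of degree 1. *)
Definition quad_mode p q v : fock :=
  cre p 0 (ann q 0 v) + cre q 0 (ann p 0 v) + mom q (mom p v).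

(** On a tame vector the terms of :p(z) q(z): of degree 0 reduce to p(-1) q(1),
    q(-1) p(1) and q(0) p(0). *)
Lemma Y_key_quad p q v : tame v ->
  Y_key B [:: (p, 0%N); (q, 0%N)] 0 1 v = quad_mode p q v.
Proof.
move=> tv; rewrite Y_key_cons.
pose F (j : nat) := heis_ij p (Negz j) (heis_ij q (1 + j%:Z) v).
pose G (j : nat) := heis_ij q (1 - j%:Z - 1) (heis_ij p (Posz j) v).
transitivity (\sum_(j \in [set: nat]) F j + \sum_(j \in [set: nat]) G j).
  by apply: (f_equal2 (fun x y : fock => x + y)); apply: eq_fsbigr => j _;
    rewrite Y_key_field.
have far r j : heis_ij r (Posz j.+2) v = 0 by rewrite -(tv r j) [ann]unlock.
have F0 : F 0%N = cre p 0 (ann q 0 v) by rewrite [cre]unlock [ann]unlock.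
have Fj j : F j.+1 = 0.
  by rewrite /F; have -> : 1 + j.+1%:Z = j.+2 by []; rewrite far linear0.
have e0 : 1 - 0%:Z - 1 = Posz 0 by lia.
have e1 : 1 - 1%:Z - 1 = Negz 0 by lia.
have G0 : G 0%N = mom q (mom p v) by rewrite /G e0 [mom]unlock.
have G1 : G 1%N = cre q 0 (ann p 0 v).
  by rewrite /G e1 [cre]unlock [ann]unlock.
have Gj j : G j.+2 = 0 by rewrite /G far linear0.
clearbody F G.
rewrite (fsbig_single (x := 0%N)) // => [|[|j] _ //].
rewrite fsbig_nat2 // F0 G0 G1 /quad_mode -[RHS]addrA; congr (_ + _).
by rewrite addrC.
Qed.
End VertexModes.

(** The enumeration of a multiset lists it in an unspecified order. *)
Lemma enum_mset2 (K : choiceType) (x y : K) :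
  enum_mset (x +` (y +` mset0))%mset = [:: x; y] \/
  enum_mset (x +` (y +` mset0))%mset = [:: y; x].
Proof.
have : perm_eq (x +` (y +` mset0))%mset [:: x; y].
  have -> : (x +` (y +` mset0))%mset = seq_mset [:: x; y].
    apply/msetP => z; rewrite mset_seqE !mset1DE mset0E /=.
    by rewrite [x == z]eq_sym [y == z]eq_sym.
  exact: perm_eq_seq_mset.
case: (enum_mset _) => [|u [|w [|t s]]] E; have := perm_size E => //= _.
have : u \in [:: x; y] by rewrite -(perm_mem E) mem_head.
rewrite !inE => /orP[] /eqP Eu; rewrite Eu in E *.
  left; move: E; rewrite perm_cons => /perm_mem/(_ y).
  by rewrite mem_head inE => /eqP ->.
right; move: E; rewrite -[[:: x; y]]/([:: x] ++ [:: y]) perm_sym perm_catC perm_cons.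
by move=> /perm_mem/(_ x); rewrite mem_head inE => /esym/eqP ->.
Qed.

Lemma second_power (F : fieldType) (V : lmodType F) (f : {linear V -> V})
    (w u1 u2 z : V) (a b : F) :
  f w = a *: u1 + b *: u2 -> f u1 = b *: z -> f u2 = a *: z ->
  f (f w) = (2 * (a * b)) *: z.
Proof.
move=> -> fu1 fu2; rewrite linearD !linearZZ fu1 fu2 !scalerA.
by rewrite -scalerDl [b * a]mulrC -mulr2n mulr_natl.
Qed.

Lemma scale_half (F : numFieldType) (V : lmodType F) (c : F) (z : V) :
  2^-1 *: ((2 * c) *: z) = c *: z.
Proof. by rewrite scalerA mulrA mulVf ?mul1r // pnatr_eq0. Qed.

Lemma order_pair_arith (k l : nat) :
  k%:R - l%:R + 0 = - 1 - 1 :> rat -> (l < 3)%N -> k = 0%N /\ l = 2%N.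
Proof.
move=> kl l3; suff : (k + 2 = l)%N by lia.
by apply/eqP; rewrite -(eqr_nat rat) natrD; apply/eqP; lra.
Qed.

Section ModeProducts.

Variables (R : realType) (n : nat) (B : 'M[rat]_8).
Local Notation C := R[i].
Local Notation fock := (fock R n).
Implicit Types (c : C) (u v w : fock) (h g : 'M[C]_(n, 8)) (a b : 'M[rat]_(n, 8)).

Local Notation ex a := (sket R mset0 a).

Lemma hannN h k v : hann h k (- v) = - hann h k v.
Proof. exact: linearN. Qed.
Lemma hann0 h k : hann h k (0 : fock) = 0.
Proof. exact: linear0. Qed.

Lemma nprodE u N v :
  nprod B u N v = fock_lin (fun x => Y_key B (enum_mset x.1) x.2 N v) u.
Proof. by []. Qed.

Lemma nprod_is_linear N v : linear (fun u => nprod B u N v : fock).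
Proof. by move=> c u w; rewrite !nprodE linearP. Qed.

Lemma nprod_ex a N v : nprod B (ex a) N v = Y_expo B a N v.
Proof. by rewrite nprodE fock_lin_sket enum_mset0. Qed.

Lemma quad_modeC p q v : quad_mode p q v = quad_mode q p v.
Proof. by rewrite /quad_mode mom_mom; congr (_ + _); rewrite addrC. Qed.

(** The order in which the two oscillators are enumerated is immaterial because
    [quad_mode] is symmetric. *)
Lemma nprod_cre2 p q v : tame v ->
  nprod B (cre p 0 (cre q 0 (ex 0))) 1 v = quad_mode p q v.
Proof.
move=> tv; rewrite !cre_sket nprodE fock_lin_sket.
rewrite -[X in Y_key B (enum_mset X)]/((p, 0%N) +` ((q, 0%N) +` mset0))%mset.
case: (enum_mset2 (p, 0%N) (q, 0%N)) => ->; rewrite Y_key_quad //.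
by rewrite quad_modeC.
Qed.

Lemma hcre2E h g v : hcre h 0 (hcre g 0 v) =
  \sum_p \sum_q (h p.1 p.2 * g q.1 q.2) *: cre p 0 (cre q 0 v).
Proof.
rewrite [LHS]hcreE; apply: eq_bigr => p _; rewrite hcreE linear_sum /= scaler_sumr.
by apply: eq_bigr => q _; rewrite creZ scalerA.
Qed.

Lemma hcre_hannE h g v : hcre h 0 (hann g 0 v) =
  \sum_p \sum_q (h p.1 p.2 * g q.1 q.2) *: cre p 0 (ann q 0 v).
Proof.
rewrite [LHS]hcreE; apply: eq_bigr => p _; rewrite hannE linear_sum /= scaler_sumr.
by apply: eq_bigr => q _; rewrite creZ scalerA.
Qed.

Lemma hmom2E h g v : hmom h (hmom g v) =
  \sum_p \sum_q (h p.1 p.2 * g q.1 q.2) *: mom p (mom q v).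
Proof.
rewrite [LHS]hmomE; apply: eq_bigr => p _; rewrite hmomE linear_sum /= scaler_sumr.
by apply: eq_bigr => q _; rewrite momZ scalerA.
Qed.

Lemma nprod_quad h g v : tame v ->
  nprod B (hcre h 0 (hcre g 0 (ex 0))) 1 v =
  hcre h 0 (hann g 0 v) + hcre g 0 (hann h 0 v) + hmom g (hmom h v).
Proof.
move=> tv; rewrite hcre2E nprodE linear_sum.
transitivity (\sum_p \sum_q (h p.1 p.2 * g q.1 q.2) *: quad_mode p q v).
  apply: eq_bigr => p _; rewrite /= linear_sum; apply: eq_bigr => q _.
  by rewrite linearZ /= -nprodE nprod_cre2.
under eq_bigr => p _.
  under eq_bigr => q _ do rewrite /quad_mode !scalerDr.
  rewrite !big_split /=; over.
rewrite !big_split.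
have E2 : hcre g 0 (hann h 0 v) =
    \sum_p \sum_q (h p.1 p.2 * g q.1 q.2) *: cre q 0 (ann p 0 v).
  rewrite [LHS]hcre_hannE [LHS]exchange_big; apply: eq_bigr => q _.
  by apply: eq_bigr => p _; rewrite mulrC.
have E3 : hmom g (hmom h v) =
    \sum_p \sum_q (h p.1 p.2 * g q.1 q.2) *: mom q (mom p v).
  rewrite [LHS]hmom2E [LHS]exchange_big; apply: eq_bigr => q _.
  by apply: eq_bigr => p _; rewrite mulrC.
by rewrite (hcre_hannE h g v) E2 E3.
Qed.

Lemma hann_cre h q v :
  hann h 0 (cre q 0 v) = cre q 0 (hann h 0 v) + h q.1 q.2 *: v.
Proof.
rewrite !hannE.
transitivity (\sum_p (cre q 0 (h p.1 p.2 *: ann p 0 v) +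
                      h p.1 p.2 *: ((p == q)%:R *: v))).
  by apply: eq_bigr => p _; rewrite ann_cre scalerDr creZ.
rewrite big_split [cre q 0 _]linear_sum; congr (_ + _).
rewrite (bigD1 q) // big1 => [|p /negPf pq].
  by rewrite [q == q]eqxx scale1r [LHS]addr0.
by rewrite pq scale0r scaler0.
Qed.

Lemma hann_cre_ex h q a : hann h 0 (cre q 0 (ex a)) = h q.1 q.2 *: ex a.
Proof. by rewrite hann_cre hann_ex (linear0 (cre q 0)) add0r. Qed.

Lemma hann_cre2_ex h p q a :
  hann h 0 (cre p 0 (cre q 0 (ex a))) =
  h p.1 p.2 *: cre q 0 (ex a) + h q.1 q.2 *: cre p 0 (ex a).
Proof. by rewrite hann_cre hann_cre_ex creZ; exact: addrC. Qed.

Lemma hann2_cre2_ex h p q a :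
  hann h 0 (hann h 0 (cre p 0 (cre q 0 (ex a)))) =
  (2 * (h p.1 p.2 * h q.1 q.2)) *: ex a.
Proof.
have := @second_power C (fock) (hann h 0) _ _ _ _ _ _ (hann_cre2_ex h p q a).
by apply; exact: hann_cre_ex.
Qed.

Lemma series_exp_at0 (X : nat -> fock -> fock) k :
  (forall m, X m 0 = 0) -> series_exp X k 0 = 0.
Proof.
move=> X0; have S0 r : forall k, series_pow X r k 0 = 0.
  elim: r => [|r IHr] j /=; first by rewrite if_same.
  by rewrite big1 // => m _; rewrite IHr.
by rewrite /series_exp big1 // => r _; rewrite S0 scaler0.
Qed.

Lemma E_minus_at0 a k : E_minus a k (0 : fock) = 0.
Proof. by apply: series_exp_at0 => m; rewrite linear0 scaler0. Qed.

(** Here <a,0> = 0 and the mode asks for k - l = -2.  The annihilation series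
    lowers the degree by [l], and the state has two oscillators of degree 1, so
    only l = 2 and k = 0 contribute, through a(1)^2 / 2. *)
Lemma Y_expo_cre2 a p q :
  Y_expo B a 1 (cre p 0 (cre q 0 (ex 0))) =
  (ratr (a p.1 p.2) * ratr (a q.1 q.2)) *: ex a.
Proof.
rewrite !cre_sket [LHS]fock_lin_sket /= eps0r scale1r addr0 dot0r.
have <- : sket R ((p, 0%N) +` ((q, 0%N) +` mset0))%mset a =
   ket R ((p, 0%N) +` ((q, 0%N) +` mset0))%mset a by rewrite [sket]unlock.
rewrite -!cre_sket; set w := cre p 0 _.
have tw : tame w by apply/tame_cre/tame_cre/tame_ex.
have ww : - hann (cplx R a) 0 (- hann (cplx R a) 0 w) =
          (2 * (ratr (a p.1 p.2) * ratr (a q.1 q.2))) *: ex a.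
  by rewrite hannN opprK hann2_cre2_ex !mxE.
clearbody w.
have w2 : E_plus a 2 w = (ratr (a p.1 p.2) * ratr (a q.1 q.2)) *: ex a.
  rewrite (E_plus_tame a 2 tw); apply: (etrans _ (scale_half _ (ex a))).
  exact: (congr1 (fun z => 2^-1 *: z) ww).
have w3 l : E_plus a l.+3 w = 0.
  rewrite (E_plus_tame a l.+3 tw) !iterSr ww hannZ hann_ex scaler0 oppr0.
  rewrite (_ : iter l _ _ = 0) ?scaler0 //.
  by elim: l => //= l ->; rewrite hann0 oppr0.
pose F (kl : nat * nat) : fock := E_minus a kl.1 (E_plus a kl.2 w).
rewrite -[LHS]/(\sum_(kl \in _) F kl).
apply: (etrans (@fsbig_single _ _ _ _ F (0, 2)%N _ _)).
- by rewrite /= rmorph1; lra.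
- move=> [k l] /= kl kl0; have [l3|l3] := leqP 3 l.
    by rewrite /F -(subnK l3) addn3 w3 E_minus_at0.
  have [k0 l2] : k = 0%N /\ l = 2%N.
    exact: (order_pair_arith kl l3).
  by rewrite k0 l2 eqxx in kl0.
- exact: (etrans (E_minus0 _ _) w2).
Qed.

Lemma Y_expo_quad a h g :
  Y_expo B a 1 (hcre h 0 (hcre g 0 (ex 0))) =
  (dot (cplx R a) h * dot (cplx R a) g) *: ex a.
Proof.
rewrite hcre2E linear_sum !dotE big_distrl /= scaler_suml.
apply: eq_bigr => p _; rewrite linear_sum big_distrr /= scaler_suml.
apply: eq_bigr => q _; rewrite linearZ /= Y_expo_cre2 scalerA !mxE.
by apply: (congr1 (fun c => c *: ex a)); rewrite mulrC mulrACA.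
Qed.

Lemma E_plusZ l a c b :
  E_plus a l (c *: ex b) = if l == 0%N then c *: ex b else 0.
Proof.
rewrite E_plus_tame; last exact/tame_scale/tame_ex.
case: l => [|l]; first by rewrite invr1 scale1r.
rewrite iterSr hannZ hann_ex scaler0 oppr0 (_ : iter l _ _ = 0) ?scaler0 //.
by elim: l => //= l ->; rewrite hann0 oppr0.
Qed.

(** There is nothing to annihilate in [ex b], so [l = 0] and [k] is determined by
    the inner product. *)
Lemma Y_expo_exE a b k : dot a b = - 2 - k%:R ->
  Y_expo B a 1 (ex b) = E_minus a k (eps R B a b *: ex (a + b)).
Proof.
move=> ab; rewrite [LHS]fock_lin_sket /= ab.
have <- : sket R mset0 (a + b) = ket R mset0 (a + b) by rewrite [sket]unlock.
pose F (kl : nat * nat) : fock :=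
  E_minus a kl.1 (E_plus a kl.2 (eps R B a b *: ex (a + b))).
rewrite -[LHS]/(\sum_(kl \in _) F kl).
apply: (etrans (@fsbig_single _ _ _ _ F (k, 0)%N _ _)).
- by rewrite /= rmorph1; lra.
- move=> [k' [|l]] /= kl kl0; last by rewrite /F E_plusZ E_minus_at0.
  have /eqP : k'%:R = k%:R :> rat by move: kl; rewrite rmorph1; lra.
  by rewrite eqr_nat => /eqP kk; rewrite kk eqxx in kl0.
- by rewrite /F E_plusZ.
Qed.

Lemma Y_expo_ex0 a b : - 2 < dot a b -> Y_expo B a 1 (ex b) = 0.
Proof.
move=> ab; rewrite [LHS]fock_lin_sket /=.
have <- : sket R mset0 (a + b) = ket R mset0 (a + b) by rewrite [sket]unlock.
apply: fsbig1 => -[k [|l]] /= kl; last by rewrite E_plusZ E_minus_at0.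
by exfalso; move: (ler0n rat k) kl; rewrite rmorph1; lra.
Qed.

End ModeProducts.

Lemma lin3 (F : pzRingType) (V : lmodType F) (c : F) (x y z x' y' z' : V) :
  (c *: x + x') + (c *: y + y') + (c *: z + z') =
  c *: (x + y + z) + (x' + y' + z').
Proof. by rewrite !scalerDr (addrACA (c *: x) x') (addrACA (c *: x + _)). Qed.

Section StateProducts.

Variables (R : realType) (n : nat) (B : 'M[rat]_8).
Local Notation C := R[i].
Local Notation fock := (fock R n).
Implicit Types (c : C) (u v w : fock) (h g : 'M[C]_(n, 8)) (a b : 'M[rat]_(n, 8)).

Local Notation ex a := (sket R mset0 a).

Lemma cre_cre p q k l v : cre p k (cre q l v) = cre q l (cre p k v).
Proof.
apply: (@fock_linear_ext R n (cre p k \o cre q l) (cre q l \o cre p k)) => s a /=.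
by rewrite !cre_sket msetDCA.
Qed.

Lemma hcre_hcre h g v : hcre h 0 (hcre g 0 v) = hcre g 0 (hcre h 0 v).
Proof.
rewrite [LHS]hcre2E [RHS]hcre2E [LHS]exchange_big; apply: eq_bigr => q _.
by apply: eq_bigr => p _; rewrite mulrC cre_cre.
Qed.

Lemma hcre_lin h k c v w : hcre h k (c *: v + w) = c *: hcre h k v + hcre h k w.
Proof. exact: linearP. Qed.

Lemma hann_lin h k c v w : hann h k (c *: v + w) = c *: hann h k v + hann h k w.
Proof. exact: linearP. Qed.

Lemma hmom_lin h c v w : hmom h (c *: v + w) = c *: hmom h v + hmom h w.
Proof. exact: linearP. Qed.

Lemma hcre_linl c h g k v : hcre (c *: h + g) k v = c *: hcre h k v + hcre g k v.
Proof. by rewrite hcreDl hcreZl. Qed.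

Lemma nprod_linl c u w v :
  nprod B (c *: u + w) 1 v = c *: nprod B u 1 v + nprod B w 1 v.
Proof. exact: nprod_is_linear. Qed.

Lemma nprod_quad_rlinear h g c v w : tame v -> tame w ->
  nprod B (hcre h 0 (hcre g 0 (ex 0))) 1 (c *: v + w) =
  c *: nprod B (hcre h 0 (hcre g 0 (ex 0))) 1 v +
  nprod B (hcre h 0 (hcre g 0 (ex 0))) 1 w.
Proof.
move=> tv tw; have tcvw := tame_lin c tv tw.
rewrite (nprod_quad B h g tcvw) (nprod_quad B h g tv) (nprod_quad B h g tw).
by rewrite !hann_lin !hmom_lin !hcre_lin lin3.
Qed.

Lemma nprod_ex_rlinear a c v w :
  nprod B (ex a) 1 (c *: v + w) = c *: nprod B (ex a) 1 v + nprod B (ex a) 1 w.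
Proof. by rewrite !nprod_ex linearP. Qed.

Lemma hann_quad f h g :
  hann f 0 (hcre h 0 (hcre g 0 (ex 0))) =
  dot f h *: hcre g 0 (ex 0) + dot f g *: hcre h 0 (ex 0).
Proof.
by rewrite !hann_hcre hann_ex (linear0 (hcre g 0)) add0r hcreZ; exact: addrC.
Qed.

Lemma hmom_quad f h g : hmom f (hcre h 0 (hcre g 0 (ex 0))) = 0.
Proof.
rewrite !hmom_hcre hmom_ex cplx0 dot0r scale0r.
by rewrite (linear0 (hcre g 0)) (linear0 (hcre h 0)).
Qed.

Lemma nprod_quad_quad h g h' g' :
  nprod B (hcre h 0 (hcre g 0 (ex 0))) 1 (hcre h' 0 (hcre g' 0 (ex 0))) =
  dot g h' *: hcre h 0 (hcre g' 0 (ex 0)) +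
  dot g g' *: hcre h 0 (hcre h' 0 (ex 0)) +
  (dot h h' *: hcre g 0 (hcre g' 0 (ex 0)) +
   dot h g' *: hcre g 0 (hcre h' 0 (ex 0))).
Proof.
rewrite nprod_quad; last exact/tame_hcre/tame_hcre/tame_ex.
rewrite !hann_quad hmom_quad (linear0 (hmom g)) addr0.
by rewrite !hcre_lin !hcreZ.
Qed.

Lemma nprod_quad_ex h g a :
  nprod B (hcre h 0 (hcre g 0 (ex 0))) 1 (ex a) =
  (dot (cplx R a) h * dot (cplx R a) g) *: ex a.
Proof.
rewrite nprod_quad; last exact: tame_ex.
rewrite !hann_ex (linear0 (hcre h 0)) (linear0 (hcre g 0)) !add0r.
rewrite hmom_ex hmomZ hmom_ex scalerA.
by apply: (congr1 (fun c => c *: ex a)); congr (_ * _); exact: dotC.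
Qed.

Lemma nprod_ex_quad h g a :
  nprod B (ex a) 1 (hcre h 0 (hcre g 0 (ex 0))) =
  (dot (cplx R a) h * dot (cplx R a) g) *: ex a.
Proof. by rewrite nprod_ex Y_expo_quad. Qed.

Lemma nprod_ex_ex0 a b : - 2 < dot a b -> nprod B (ex a) 1 (ex b) = 0.
Proof. by move=> ab; rewrite nprod_ex Y_expo_ex0. Qed.

(** A pole of order exactly 2: the creation series contributes its constant
    term. *)
Lemma nprod_ex_ex2 a b : dot a b = - 2 ->
  nprod B (ex a) 1 (ex b) = eps R B a b *: ex (a + b).
Proof.
by move=> ab; rewrite nprod_ex (@Y_expo_exE _ _ _ _ _ 0) ?E_minus0.
Qed.

Lemma E_minus2Z a c v : E_minus a 2 (c *: v) = c *: E_minus a 2 v.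
Proof. by rewrite !E_minus2 !hcreZ -scalerDr !scalerA mulrC. Qed.

(** A pole of order 4: the creation series contributes its coefficient of z^2. *)
Lemma nprod_ex_exN a : dot a a = 4 ->
  nprod B (ex a) 1 (ex (- a)) = (eps R B a (- a) / 2) *:
     (hcre (cplx R a) 1 (ex 0) + hcre (cplx R a) 0 (hcre (cplx R a) 0 (ex 0))).
Proof.
move=> aa; rewrite nprod_ex (@Y_expo_exE _ _ _ _ _ 2); last first.
  by rewrite /dot linearN /= mulmxN linearN /= -/(dot a a) aa.
by rewrite subrr E_minus2Z E_minus2 scalerA.
Qed.

Lemma expoE a : expo R a = ex a.
Proof. by rewrite [sket]unlock. Qed.

(** The orthonormal basis consists of the [tens x (delta_mx 0 j)] divided by the
    square root of 2, whence 1/4 instead of 1/2. *)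
Lemma omega_MalphaE (x : 'rV[rat]_n) :
  omega (Malpha_basis R x) = 4^-1 *: \sum_j
    hcre (cplx R (tens x (delta_mx 0 j))) 0
      (hcre (cplx R (tens x (delta_mx 0 j))) 0 (ex 0)).
Proof.
rewrite /omega; transitivity (2^-1 *: \sum_j 2^-1 *:
    (hcre (cplx R (tens x (delta_mx 0 j))) 0
      (hcre (cplx R (tens x (delta_mx 0 j))) 0 (ex 0))) : fock); last first.
  by rewrite -scaler_sumr scalerA -invfM -natrM.
apply: (congr1 (fun z => 2^-1 *: z)); apply: eq_bigr => j _.
transitivity (hcre (Malpha_basis R x j) 0 (hcre (Malpha_basis R x j) 0 (ex 0))).
  by rewrite [hcre]unlock [sket]unlock.
by rewrite /Malpha_basis !hcreZl hcreZ scalerA -invfM -expr2 sqrtCK.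
Qed.

End StateProducts.

(** * The Ising vectors in the Fock space *)

Section IsingVectors.

Variables (R : realType) (n : nat) (B : 'M[rat]_8).
Local Notation C := R[i].
Local Notation fock := (fock R n).
Local Notation ex := (sket R mset0).

Definition fquad (h g : 'M[C]_(n, 8)) : fock := hcre h 0 (hcre g 0 (ex 0)).
Definition fdesc (h : 'M[C]_(n, 8)) : fock := hcre h 1 (ex 0).

(** The Ising vector with the sum over the positive roots of E8 replaced by one
    over all roots. *)
Definition ising_model : 'rV[rat]_n -> fock :=
  @AbstractGriess.ising_elt C fock n fquad ex.

Lemma fquad_lin c h h' g : fquad (c *: h + h') g = c *: fquad h g + fquad h' g.
Proof. exact: hcre_linl. Qed.

Lemma fquadC h g : fquad h g = fquad g h.
Proof. exact: hcre_hcre. Qed.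

Lemma fdescN h : fdesc (- h) = - fdesc h.
Proof. by rewrite /fdesc -(scaleN1r h) hcreZl scaleN1r. Qed.

Lemma tame_fquad h g : tame (fquad h g).
Proof. exact/tame_hcre/tame_hcre/tame_ex. Qed.

Local Notation prod := (fun u v : fock => nprod B u 1 v).

Lemma fquad_rlinear h g :
  @AbstractGriess.rlinear C fock prod (@tame R n) (fquad h g).
Proof. by move=> c v w tv tw; exact: nprod_quad_rlinear. Qed.

Lemma ex_rlinear a : @AbstractGriess.rlinear C fock prod (@tame R n) (ex a).
Proof. by move=> c v w _ _; exact: nprod_ex_rlinear. Qed.

Lemma tame_ising_model x : tame (ising_model x).
Proof.
exact: (@AbstractGriess.tame_ising_elt C fock n fquad ex _ (@tame_lin R n)
  tame_fquad (@tame_ex R n)).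
Qed.

Lemma ising_model_rlinear x c v w : tame v -> tame w ->
  prod (ising_model x) (c *: v + w) =
  c *: prod (ising_model x) v + prod (ising_model x) w.
Proof.
exact: (@AbstractGriess.rlinear_ising_elt C fock n fquad ex prod (@tame R n)
  (@nprod_linl R n B) fquad_rlinear ex_rlinear).
Qed.

Lemma ising_modelN x : ising_model (- x) = ising_model x.
Proof. exact: (@AbstractGriess.ising_eltN C fock n fquad ex fquad_lin fquadC). Qed.

Lemma ising_model_orth x y : dot x y = 0 ->
  prod (ising_model x) (ising_model y) = 0.
Proof.
exact: (@AbstractGriess.mul_ising_elt_orth C fock n fquad ex prod (@tame R n)
  (@tame_lin R n)
  tame_fquad (@tame_ex R n) (@nprod_linl R n B) fquad_rlinear ex_rlinear
  (@nprod_quad_quad R n B) (@nprod_quad_ex R n B) (@nprod_ex_quad R n B)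
  (@nprod_ex_ex0 R n B)).
Qed.

Hypothesis Bbasis : root_basis_E8 B.

Lemma ising_model_adj (x y : 'rV[rat]_n) :
  (forall i, 2 * x 0 i \is a Num.int) -> (forall i, 2 * y 0 i \is a Num.int) ->
  dot x y = -1 ->
  prod (ising_model x) (ising_model y) =
  32^-1 *: (ising_model x + ising_model y - ising_model (x + y)).
Proof.
move=> xZ yZ xy.
apply: (@AbstractGriess.mul_ising_elt_adj C fock n fquad ex prod (@tame R n)
  (@eps R B n)
  fquad_lin fquadC (@tame_lin R n)
  tame_fquad (@tame_ex R n) (@nprod_linl R n B) fquad_rlinear ex_rlinear
  (@nprod_quad_quad R n B) (@nprod_quad_ex R n B) (@nprod_ex_quad R n B)
  (@nprod_ex_ex0 R n B) (@nprod_ex_ex2 R n B) x y xy) => u uE u2.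
exact: eps_tens_opp.
Qed.

Lemma ising_model_same (x : 'rV[rat]_n) :
  (forall i, 2 * x 0 i \is a Num.int) -> dot x x = 2 ->
  prod (ising_model x) (ising_model x) = 2 *: ising_model x.
Proof.
move=> xZ xx.
apply: (@AbstractGriess.mul_ising_elt_same C fock n fquad fdesc ex prod
  (@tame R n) (@eps R B n)
  fquad_lin fquadC fdescN (@tame_lin R n)
  tame_fquad (@tame_ex R n) (@nprod_linl R n B) fquad_rlinear ex_rlinear
  (@nprod_quad_quad R n B) (@nprod_quad_ex R n B) (@nprod_ex_quad R n B)
  (@nprod_ex_ex0 R n B) (@nprod_ex_ex2 R n B) (@nprod_ex_exN R n B) x xx) => u v uE vE.
exact: eps_tens_same.
Qed.

End IsingVectors.

(** A positive system and its negative partition the roots. *)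
Lemma big_positive_E8 (V : nmodType) (PE : {fset 'rV[rat]_8}) (f : 'rV[rat]_8 -> V) :
  positive_roots latE8 PE ->
  \sum_(b <- PE) (f b + f (- b)) = \sum_(b <- E8_roots) f b.
Proof.
move=> [PEr PEx _]; rewrite big_split /= -(big_map (fun b => - b) xpredT f).
rewrite -big_cat; apply: perm_big; apply: uniq_perm.
- rewrite cat_uniq fset_uniq map_inj_uniq ?fset_uniq ?andbT /=; last exact: oppr_inj.
  apply/hasPn => _ /mapP[b bP ->]; apply/negP => bN.
  by have := PEx _ (PEr _ bP); rewrite bP bN.
- exact: uniq_E8_roots.
move=> b; rewrite mem_cat; apply/orP/idP => [[bP|/mapP[c cP ->]]|bP].
- by apply/mem_E8_roots; exact: PEr.
- by rewrite Phi_opp; apply/mem_E8_roots; exact: PEr.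
have /PEx := (mem_E8_roots b).1 bP; case bPE: (b \in PE); first by left.
move=> bN; right; apply/mapP; exists (- b); last by rewrite opprK.
by case: (- b \in PE) bN.
Qed.

(** The inner product of the two tensors is 4, which forces both factors of
    [dot x y * dot u v] to be 2 or both to be -2. *)
Lemma tens_inj_norm2 n (x y : 'rV[rat]_n) (u v : 'rV[rat]_8) :
  dot x x = 2 -> dot y y = 2 -> dot u u = 2 -> dot v v = 2 ->
  dot x y \is a Num.int -> dot u v \is a Num.int ->
  tens x u = tens y v -> (x = y /\ u = v) \/ (y = - x /\ v = - u).
Proof.
move=> xx yy uu vv xy uv e.
have : dot x y * dot u v = 4.
  rewrite -dot_tens {1}e dot_tens yy vv; lra.
have := norm2_bound xx yy xy; have := norm2_bound uu vv uv; rewrite !inE.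
case/or4P => [/eqP u0|/eqP u0|/eqP u0|/orP[/eqP u0|/eqP u0]];
case/or4P => [/eqP x0|/eqP x0|/eqP x0|/orP[/eqP x0|/eqP x0]];
rewrite u0 x0 // => _.
- by right; split; exact: norm2_opp.
- by left; split; exact: norm2_eq.
Qed.

Section Coefficients.

Variables (R : realType) (n : nat).
Local Notation C := R[i].
Local Notation fock := (fock R n).
Local Notation ex := (sket R mset0).

Lemma isingE (PE : {fset 'rV[rat]_8}) (x : 'rV[rat]_n) :
  positive_roots latE8 PE -> ising R PE x = ising_model R x.
Proof.
move=> PEpos; rewrite /ising omega_MalphaE /ising_model.
rewrite /AbstractGriess.ising_elt /AbstractGriess.exp_sum scalerA -invfM -natrM.
rewrite -(big_positive_E8 (fun b => ex (tens x b)) PEpos).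
apply: (congr1 (fun z => _ + 32^-1 *: z)); apply: eq_bigr => b _.
by rewrite !expoE tensNr.
Qed.

Lemma mcoeff_fquad h g a : (fquad h g : fock)@_(mset0, a) = 0.
Proof.
rewrite /fquad hcre2E raddf_sum big1 // => p _; rewrite raddf_sum big1 // => q _.
rewrite /= mcoeff_scale !cre_sket mcoeff_sket xpair_eqE.
have -> : ((p, 0%N) +` ((q, 0%N) +` mset0) == mset0 :> {mset osc n})%mset = false.
  apply/negP => /eqP /msetP /(_ (p, 0%N)).
  by rewrite mset1DE mset0E eqxx.
by rewrite mulr0.
Qed.

(** Only the exponential part of e(x) involves monomials without oscillators. *)
Lemma mcoeff_ising_model (x : 'rV[rat]_n) a :
  (ising_model R x)@_(mset0, a) =
  32^-1 * (count (fun b => tens x b == a) E8_roots)%:R.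
Proof.
rewrite [LHS]mcoeff_lin mcoeff_scale /AbstractGriess.pair_sum /AbstractGriess.exp_sum.
rewrite raddf_sum big1 => [|j _]; last exact: mcoeff_fquad.
rewrite mulr0 add0r raddf_sum; congr (_ * _).
rewrite -sum1_count natr_sum [RHS]big_mkcond; apply: eq_bigr => b _.
by rewrite /= mcoeff_sket xpair_eqE eqxx /=; case: (_ == _).
Qed.

Lemma weight_subspace d : is_subspace (@weight_space R n d).
Proof.
split=> [x|c u v ud vd x]; first by rewrite msupp0.
rewrite -mcoeff_neq0 mcoeff_lin => xuv.
have [xu|xu] := boolP (x \in msupp u); first exact: ud.
have [xv|xv] := boolP (x \in msupp v); first exact: vd.
by rewrite !mcoeff_outdom // mulr0 addr0 eqxx in xuv.
Qed.

Lemma weight_sket (s : {mset osc n}%mset) a d :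
  weight (s, a) = d -> weight_space d (sket R s a).
Proof.
move=> sd x; rewrite -mcoeff_neq0 mcoeff_sket.
by have [<-//|_] := eqVneq (s, a) x; rewrite eqxx.
Qed.

Lemma subspaceZ (V : lmodType C) (U : set V) c v : is_subspace U -> U v -> U (c *: v).
Proof. by move=> [U0 UD] Uv; rewrite -[_ *: v]addr0; apply: UD. Qed.

Lemma subspace_sum (V : lmodType C) (U : set V) (I : Type) (r : seq I) (f : I -> V) :
  is_subspace U -> (forall i, U (f i)) -> U (\sum_(i <- r) f i).
Proof.
move=> [U0 UD] Uf; elim/big_ind: _ => // x y Ux Uy.
by rewrite -[x]scale1r; exact: UD.
Qed.

Lemma weight_fquad h g : weight_space 2 (fquad h g : fock).
Proof.
have W := weight_subspace 2; rewrite /fquad hcre2E.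
apply: (subspace_sum _ W) => p; apply: (subspace_sum _ W) => q.
refine (subspaceZ _ W _); rewrite !cre_sket; refine (weight_sket _).
rewrite /weight dot0r mul0r addr0.
by case: (enum_mset2 (p, 0%N) (q, 0%N)) => ->; rewrite !big_cons big_nil.
Qed.

Lemma weight_ising_model (x : 'rV[rat]_n) : dot x x = 2 ->
  weight_space 2 (ising_model R x).
Proof.
move=> xx; have W := weight_subspace 2; rewrite /ising_model /AbstractGriess.ising_elt.
apply: W.2; first by apply: (subspace_sum _ W) => j; exact: weight_fquad.
refine (subspaceZ _ W _); rewrite /AbstractGriess.exp_sum big_seq.
elim/big_ind: _ => [|u v wu wv|b bP]; first exact: W.1.
  by rewrite -[u]scale1r; apply: W.2.
refine (weight_sket _).
by rewrite /weight enum_mset0 big_nil dot_tens xx Phi_norm.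
Qed.

End Coefficients.

Section Main.

Variables (R : realType) (n : nat) (Q : set 'rV[rat]_n).
Variables (P : {fset 'rV[rat]_n}) (B : 'M[rat]_8) (PE : {fset 'rV[rat]_8}).
Hypothesis Qh : half_integral_lattice Q.
Hypothesis Ppos : positive_roots Q P.
Hypothesis Bbasis : root_basis_E8 B.
Hypothesis PEpos : positive_roots latE8 PE.

Local Notation S := (ising_vectors R P PE).

(** Either [x] or [- x] is positive, and both give the same Ising vector. *)
Lemma ising_span x : Defs.roots Q x -> lspan S (ising_model R x).
Proof.
case: Ppos => _ Px _ xr.
have mem y : y \in P -> lspan S (ising_model R y).
  by move=> yP; apply: sub_lspan; exists y; [exact: yP|exact: isingE].
have := Px x xr; case xP: (x \in P); first by move=> _; exact: mem.
case NxP: (- x \in P) => // _.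
by rewrite -ising_modelN; exact: mem.
Qed.

(** The case of inner product 1 is reduced to -1 by replacing [y] by [- y], and
    those of inner product 2 and -2 to [x = y]. *)
Lemma span_closed_gen x y : Defs.roots Q x -> Defs.roots Q y ->
  lspan S (nprod B (ising_model R x) 1 (ising_model R y)).
Proof.
move=> xr yr.
have halfZ z : Defs.roots Q z -> forall i, 2 * z 0 i \is a Num.int.
  by move=> [Qz _] i; case: Qh => _ _; apply.
have adj z t : Defs.roots Q z -> Defs.roots Q t -> dot z t = -1 ->
    lspan S (nprod B (ising_model R z) 1 (ising_model R t)).
  move=> zr tr zt; rewrite (ising_model_adj R Bbasis (halfZ _ zr) (halfZ _ tr) zt).
  apply: lspanZ; rewrite -[- ising_model R _]scaleN1r.
  apply: lspanD; first by apply: lspanD; exact: ising_span.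
  by apply: lspanZ; apply: ising_span; exact: (roots_add Qh zr tr zt).
have same z : Defs.roots Q z ->
    lspan S (nprod B (ising_model R z) 1 (ising_model R z)).
  move=> zr; rewrite (ising_model_same R Bbasis (halfZ _ zr) zr.2).
  by apply: lspanZ; apply: ising_span.
have := roots_dot Qh xr yr; rewrite !inE.
case/or4P => [/eqP xy|/eqP xy|/eqP xy|/orP[/eqP xy|/eqP xy]].
- by rewrite (norm2_opp xr.2 yr.2 xy) ising_modelN; exact: same.
- exact: adj.
- rewrite (ising_model_orth R B xy); exact: (lspan_subspace S).1.
- rewrite -(ising_modelN R y); apply: adj => //; first exact: roots_opp.
  by rewrite dotNr xy.
- by rewrite (norm2_eq xr.2 yr.2 xy); exact: same.
Qed.

Lemma S_gen u : S u -> exists2 x, Defs.roots Q x & u = ising_model R x.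
Proof.
case: Ppos => Pr _ _ [x xP <-]; exists x; first exact: Pr.
exact: isingE.
Qed.

(** Bilinearity; in the second argument it is used inside the subspace of tame
    vectors. *)
Lemma span_closed u v : lspan S u -> lspan S v -> lspan S (nprod B u 1 v).
Proof.
move=> Su Sv; move: u Su v Sv.
apply: (@lspan_min _ _ _ [set u | forall v, lspan S v -> lspan S (nprod B u 1 v)]).
  split=> [v Sv|c u w Hu Hw v Sv].
    have := nprod_linl B (-1) 0 0 v; rewrite scaler0 addr0 scaleN1r addNr => ->.
    exact: (lspan_subspace S).1.
  rewrite nprod_linl; apply: (lspan_subspace S).2; [exact: Hu|exact: Hw].
move=> u /S_gen[x xr ->] v.
suff H : (lspan S `<=` [set w | tame w /\
    lspan S (nprod B (ising_model R x) 1 w)])%classic.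
  by move=> /H[].
apply: lspan_min.
  split=> [|c w t [tw Hw] [tt Ht]].
    split; first exact: (tame_subspace R n).1.
    have t0 := (tame_subspace R n).1.
    have := ising_model_rlinear B x (-1) t0 t0.
    rewrite scaler0 addr0 scaleN1r addNr => ->.
    exact: (lspan_subspace S).1.
  split; first exact: tame_lin.
  rewrite ising_model_rlinear //; exact: (lspan_subspace S).2.
move=> w /S_gen[y yr ->]; split; first exact: tame_ising_model.
exact: span_closed_gen.
Qed.

(** [W_R] is an intersection of subspaces containing the generators, so it
    contains their span; closure under the product makes the span minimal. *)
Lemma G_R_span : G_R R B Q P PE = lspan S.
Proof.
apply/seteqP; split; last first.
  move=> u Su U [[_ Us _] SU]; exact: (lspan_min Us SU).
apply: smallest_sub; last exact: sub_lspan.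
split=> [u Su|//|]; last exact: span_closed.
- split.
    by move=> U [[_ Us _ _] SU]; apply: (lspan_min Us SU).
  move: u Su; apply: lspan_min; first exact: weight_subspace.
  by move=> u /S_gen[x xr ->]; apply: weight_ising_model; exact: xr.2.
- exact: lspan_subspace.
Qed.

(** For positive [x] and [y] the alternative [y = - x] of [tens_inj_norm2] is
    excluded. *)
Lemma mcoeff_positive x y b : x \in P -> y \in P -> b \in E8_roots ->
  count (fun c => tens x c == tens y b) E8_roots = (x == y).
Proof.
case: Ppos => Pr Px _ xP yP bP.
have [Qx xx] := Pr _ xP; have [Qy yy] := Pr _ yP.
have key c : c \in E8_roots -> tens x c = tens y b -> x = y /\ c = b.
  move=> cP e; case: (@tens_inj_norm2 _ x y c b) => //; rewrite ?Phi_norm //.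
  - by case: Qh => _ + _; apply.
  - by apply: latE8_dot_int; exact: Phi_lat.
  - by case=> yx _; have := Px x (Pr x xP); rewrite -yx xP yP.
have [xy|xy] := eqVneq x y.
  rewrite -xy in key *; rewrite (@eq_in_count _ _ (pred1 b)).
    by rewrite count_uniq_mem ?uniq_E8_roots ?bP.
  move=> c cP /=; apply/eqP/eqP => [/(key _ cP)[]//|->//].
apply/eqP; rewrite -[_ == _]negbK -lt0n -has_count; apply/hasPn => c cP.
by apply/eqP => /(key c cP)[/eqP]; rewrite (negPf xy).
Qed.

(** Any root of E8 detects the coefficients; the first one of the list is taken. *)
Lemma ising_has_dim : has_dim (lspan S) #|` P|.
Proof.
have Psize : size P = #|` P| by [].
pose x (i : 'I_#|` P|) : 'rV[rat]_n := nth 0 P i.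
have xP i : x i \in P by rewrite mem_nth.
have x_inj i j : (x i == x j) = (i == j).
  by rewrite /x nth_uniq ?fset_uniq.
exists (fun i => ising_model R (x i)); split.
  move=> c c0 i.
  (* The coefficient of e^{x_i (x) b} isolates [c i]. *)
  have b0 : half_vec (nth [::] E8_words 0) \in E8_roots.
    by apply/mem_E8_roots/half_vec_root/mem_nth.
  set b := half_vec _ in b0.
  have := congr1 (mcoeff (mset0, tens (x i) b)) c0.
  rewrite mcoeff0 raddf_sum (bigD1 i) //= big1 => [|j ji].
    rewrite addr0 mcoeff_scale mcoeff_ising_model mcoeff_positive // eqxx mulr1.
    move/eqP; rewrite mulf_eq0 invr_eq0 pnatr_eq0 orbF => /eqP //.
  rewrite mcoeff_scale mcoeff_ising_model mcoeff_positive // x_inj (negPf ji).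
  by rewrite !mulr0.
congr lspan; apply/seteqP; split=> [_ [a aP <-]|_ [i _ <-]].
  have aP' : a \in P by [].
  have ai : (index a P < #|` P|)%N by rewrite index_mem.
  exists (Ordinal ai); first by [].
  apply: (etrans _ (esym (isingE R a PEpos))).
  by apply: (congr1 (@ising_model R n)); rewrite /x /= nth_index.
by exists (x i); [exact: xP|exact: isingE].
Qed.

End Main.

Theorem lemma4p2 (R : realType) (n : nat) (Q : set 'rV[rat]_n)
    (P : {fset 'rV[rat]_n}) (B : 'M[rat]_8) (PE : {fset 'rV[rat]_8}) :
  is_root_lattice Q ->
  positive_roots Q P ->
  root_basis_E8 B ->
  positive_roots latE8 PE ->
  G_R R B Q P PE = lspan (ising_vectors R P PE) /\
  has_dim (G_R R B Q P PE) #|` P|.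
Proof.
move=> /root_lattice_half_integral Qh Ppos Bbasis PEpos.
rewrite (G_R_span R Qh Ppos Bbasis PEpos); split=> //.
exact: (ising_has_dim R Qh Ppos PEpos).
Qed.
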